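(* The passport $\langle(3,2,1),(3,1,1,1),(6)\rangle$ contains exactly two plane trees. They form a single $G_{\mathbb{Q}}$-orbit, and the field of moduli of each is the imaginary quadratic field $\mathbb{Q}(i)$ (a common embedded field, since $\mathbb{Q}(i)/\mathbb{Q}$ is Galois and hence stable under conjugation of stabilizers). In the normalization $p(z)=c\,z^3(z-1)^2(z-a)$ (black vertices of degrees $3,2,1$ at $0,1,a$) they are given by the two roots $$a=\frac{16\pm12\,i}{25}$$ of $25a^2-32a+16$, this polynomial being the quadratic factor of the resultant $\mathrm{Res}_c(E_1,E_2)=-432\,(25a^2-32a+16)^3(25a^3-12a^2-24a-16)^2$ of $E_1=(3125a^6-7500a^5+4800a^4-112a^3-96a^2+1536a-1024)\,c+93312$ and $E_2=a^4(a-1)^3c^2-432$.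
   Context: $G_{\mathbb{Q}}=\mathrm{Gal}(\overline{\mathbb{Q}}/\mathbb{Q})$, with $\overline{\mathbb{Q}}\subset\mathbb{C}$. A Belyi map is a non-constant morphism $t\colon X\to\mathbb{P}^1$ from a smooth projective connected curve over $\mathbb{C}$ branched only over $\{0,1,\infty\}$; isomorphisms commute with the maps to $\mathbb{P}^1$. Its dessin is the bipartite graph $t^{-1}([0,1])$ embedded in $X$, with black vertices $t^{-1}(0)$ and white vertices $t^{-1}(1)$; the passport is the triple of partitions of $\deg t$ given by ramification indices over $0,1,\infty$. Plane trees with $d$ edges (bipartitely coloured, up to isomorphism of oriented embedded graphs) are exactly the dessins of polynomial Belyi maps of degree $d$ on $\mathbb{P}^1$, determined up to affine substitution $z\mapsto\alpha z+\beta$. The equations $E_1=E_2=0$ express that $p(u)=p(v)=1$ at the two roots $u,v$ of $6z^2-(4+5a)z+3a$ (the critical points of $p$ other than $0,1$); $c$ is determined by $a$ through $E_1=0$. $G_{\mathbb{Q}}$ acts on isomorphism classes of dessins by applying $\sigma$ to the coefficients of a model over $\overline{\mathbb{Q}}$. The field of moduli of a dessin is the fixed field in $\overline{\mathbb{Q}}$ of its stabilizer in $G_{\mathbb{Q}}$. *)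

(* Defs.v *)
From HB Require Import structures.
From mathcomp Require Import all_boot all_order all_fingroup all_algebra all_field.
From mathcomp Require Import reals complex.

Set Implicit Arguments.
Unset Strict Implicit.
Unset Printing Implicit Defensive.

Import Order.TTheory GRing.Theory Num.Theory.

Local Open Scope ring_scope.

Definition exactly_two_classes (T : Type) (P : T -> Prop) (E : T -> T -> Prop)
    : Prop :=
  exists x y : T,
    [/\ P x, P y, ~ E x y & forall z : T, P z -> E z x \/ E z y].

(* The partitions over 0, 1 and infinity, each one listed in any order. *)
Definition passport : Type := (seq nat * seq nat * seq nat)%type.

Definition passport_321 : passport :=
  ([:: 3; 2; 1]%N, [:: 3; 1; 1; 1]%N, [:: 6]%N).

(* Bipartitely coloured plane trees up to isomorphism of oriented embedded    *)
(* graphs. The edges are labelled by 'I_d; s.1 (resp. s.2) sends an edge to   *)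
(* the next one counterclockwise around its black (resp. white) end. So the   *)
(* black vertices are the orbits of s.1, the white ones those of s.2, and the *)
(* faces the orbits of s.1 * s.2. A connected graph is a tree exactly when it *)
(* has one vertex more than it has edges.                                     *)
Definition cycle_type (d : nat) (s : 'S_d) : seq nat :=
  [seq #|pred_of_set c| | c <- enum (porbits s)].

Definition plane_tree (d : nat) (s : 'S_d * 'S_d) : Prop :=
  [transitive <<[set s.1; s.2]>>%g, on [set: 'I_d] | 'P]
  /\ (#|porbits s.1| + #|porbits s.2| = d.+1)%N.

Definition tree_has_passport (d : nat) (L : passport) (s : 'S_d * 'S_d) : Prop :=
  [/\ perm_eq (cycle_type s.1) L.1.1,
      perm_eq (cycle_type s.2) L.1.2
    & perm_eq (cycle_type (s.1 * s.2)%g) L.2].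

Definition tree_iso (d : nat) (s t : 'S_d * 'S_d) : Prop :=
  exists g : 'S_d, t.1 = (s.1 ^ g)%g /\ t.2 = (s.2 ^ g)%g.

Section PolynomialBelyiMaps.

Variable C : numClosedFieldType.

(* Branching over infinity is allowed, so only the finite critical values are *)
(* constrained.                                                               *)
Definition polynomial_belyi_map (p : {poly C}) : Prop :=
  (1 < size p)%N /\ forall z : C, root p^`() z -> p.[z] = 0 \/ p.[z] = 1.

Definition ramification_over (p : {poly C}) (w : C) (l : seq nat) : Prop :=
  exists rs : seq C,
    [/\ uniq rs, forall z : C, (z \in rs) = (p.[z] == w)
      & perm_eq [seq mup z (p - w%:P) | z <- rs] l].

(* The only point over infinity is infinity, with ramification index deg p.   *)
Definition has_passport (L : passport) (p : {poly C}) : Prop :=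
  [/\ ramification_over p 0 L.1.1, ramification_over p 1 L.1.2
    & perm_eq [:: (size p).-1] L.2].

(* An isomorphism over P^1 of polynomial maps preserves the unique pole, so   *)
(* it is an affine substitution.                                              *)
Definition belyi_iso (p q : {poly C}) : Prop :=
  exists alpha beta : C, alpha != 0 /\ p = q \Po (alpha *: 'X + beta%:P).

(* The plane trees with passport L: by the correspondence between plane trees *)
(* and dessins of polynomial Belyi maps, they are the classes for belyi_iso   *)
(* of the polynomials below.                                                  *)
Definition tree_polynomial (L : passport) (p : {poly C}) : Prop :=
  polynomial_belyi_map p /\ has_passport L p.

Definition normal_form (a c : C) : {poly C} :=
  c *: ('X ^+ 3 * ('X - 1) ^+ 2 * ('X - a%:P)).

End PolynomialBelyiMaps.

Section GaloisAction.

(* algC is the field of algebraic numbers and iota its inclusion in C. A ring *)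
(* endomorphism of algC is bijective (its inverse is algC_invaut), so         *)
(* {rmorphism algC -> algC} is the absolute Galois group of the rationals.    *)
Variables (C : numClosedFieldType) (iota : {rmorphism algC -> C}).

(* The dessin of q is the image under sigma of that of p: p has a model m     *)
(* over algC such that q is isomorphic to the conjugate of m by sigma.        *)
Definition galois_conjugate (sigma : {rmorphism algC -> algC})
    (p q : {poly C}) : Prop :=
  exists m : {poly algC},
    belyi_iso p (map_poly iota m)
    /\ belyi_iso q (map_poly iota (map_poly sigma m)).

Definition in_galois_stabilizer (p : {poly C})
    (sigma : {rmorphism algC -> algC}) : Prop :=
  galois_conjugate sigma p p.

Definition in_field_of_moduli (p : {poly C}) (x : algC) : Prop :=
  forall sigma : {rmorphism algC -> algC},
    in_galois_stabilizer p sigma -> sigma x = x.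

End GaloisAction.

(* Q(z), the intersection of all the subfields of algC that contain z. *)
Definition in_rational_adjunction (z x : algC) : Prop :=
  forall S : {pred algC}, divring_closed S -> z \in S -> x \in S.

Set Warnings "-abstract-large-number".

Definition quadratic_factor (A : comNzRingType) (a : A) : A :=
  25%:R * a ^+ 2 - 32%:R * a + 16%:R.

Definition cubic_factor (A : comNzRingType) (a : A) : A :=
  25%:R * a ^+ 3 - 12%:R * a ^+ 2 - 24%:R * a - 16%:R.

Definition E1 (A : comNzRingType) (a c : A) : A :=
  (3125%:R * a ^+ 6 - 7500%:R * a ^+ 5 + 4800%:R * a ^+ 4 - 112%:R * a ^+ 3
   - 96%:R * a ^+ 2 + 1536%:R * a - 1024%:R) * c + 93312%:R.

Definition E2 (A : comNzRingType) (a c : A) : A :=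
  a ^+ 4 * (a - 1) ^+ 3 * c ^+ 2 - 432%:R.

(* E1 and E2 as polynomials in c with coefficients in Q[a]. *)
Definition E1_poly : {poly {poly rat}} := E1 ('X : {poly rat})%:P 'X.

Definition E2_poly : {poly {poly rat}} := E2 ('X : {poly rat})%:P 'X.

(* Main.v *)
(* A tree of the passport is a polynomial of degree 6 whose roots have the    *)
(* multiplicities 3, 2, 1; an affine substitution moves the first two to 0    *)
(* and 1, which gives p = c z^3 (z - 1)^2 (z - a), and then leaves no freedom.*)
(* The white vertex of degree 3 is a point where p = 1 and                    *)
(* p' = c z^2 (z - 1) (6 z^2 - (4 + 5a) z + 3a) vanishes twice, so the        *)
(* discriminant 25 a^2 - 32 a + 16 of the last factor vanishes, and p = 1     *)
(* there determines c. Hence a is a complete invariant of the tree; it is     *)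
(* compatible with the Galois action, and sigma fixes a exactly when it fixes *)
(* i. The field of moduli is thus the fixed field of the automorphisms that   *)
(* fix i, which is Q(i) by Galois theory. On the combinatorial side, the      *)
(* 3-cycle of the white rotation has to meet each of the three cycles of the  *)
(* black one, and the two cyclic orders give the two trees.                   *)

Require Import Defs.
From HB Require Import structures.
From mathcomp Require Import all_boot all_order all_fingroup all_algebra all_field.
From mathcomp Require Import ring lra.
From mathcomp Require Import reals complex.

Set Implicit Arguments.
Unset Strict Implicit.
Unset Printing Implicit Defensive.

Import Order.TTheory GRing.Theory Num.Theory.
Local Open Scope ring_scope.

(** Everything about the polynomials reduces to the number [a]. [tree_normal_form] brings a tree to
    a normal form, [tree_normal_formP] turns the passport condition into [quadratic_factor a = 0]
    together with [E1 a c = 0], and [E1_quadratic_root] solves the latter uniquely for [c] as a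
    polynomial in [a] with rational coefficients. Since [normal_form_unique] recovers [a] from the
    isomorphism class, the classes correspond to the two roots of the quadratic factor, with
    representatives [tree_model a].

    The coefficients of [tree_model a] are rational expressions in [a], so an automorphism sigma
    carries the tree of [a] to the tree of [sigma a] ([galois_conjugate_tree]). Complex conjugation
    swaps the two roots, hence a single orbit; the stabilizer of either tree consists of the
    automorphisms fixing i, and [algC_fixed_subfield] shows that these fix nothing outside Q(i).

    The count of trees as pairs of permutations is a separate argument:
    [plane_tree_321_classification] labels the edges canonically from the white 3-cycle. The
    resultant is a 3 by 3 determinant followed by a polynomial identity. *)

(** * Multiplicities of roots *)

Lemma mup_decomposition (F : fieldType) (p : {poly F}) (z : F) : p != 0 ->
  exists2 q, ~~ root q z & p = q * ('X - z%:P) ^+ mup z p.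
Proof.
move=> p0; have [m [q]] := multiplicity_XsubC p z; rewrite p0 /= => qz Dp.
by exists q; rewrite // {2}Dp mupMr // mup_XsubCX eqxx.
Qed.

(** In characteristic 0, p = q (X - z)^(m+1) has derivative (q' (X - z) + (m+1) q) (X - z)^m, and
    the first factor takes the nonzero value (m+1) q(z) at z. *)
Lemma mup_deriv (F : numFieldType) (p : {poly F}) (z : F) :
  p != 0 -> root p z -> mup z p = (mup z p^`()).+1.
Proof.
move=> p0 pz; have [q qz Dp] := mup_decomposition z p0.
case Dm: (mup z p) => [|m] in Dp *.
  by rewrite expr0 mulr1 in Dp; rewrite Dp (negPf qz) in pz.
have ->: p^`() = (q^`() * ('X - z%:P) + q *+ m.+1) * ('X - z%:P) ^+ m.
  rewrite Dp derivM deriv_exp derivXsubC mul1r /= exprS mulrA mulrDl.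
  by rewrite mulrnAl mulrnAr.
rewrite mupMr ?mup_XsubCX ?eqxx // /root hornerD hornerM hornerXsubC subrr mulr0.
by rewrite add0r hornerMn mulrn_eq0.
Qed.

Lemma mup_map (F K : fieldType) (f : {rmorphism F -> K}) (p : {poly F}) (z : F) :
  p != 0 -> mup (f z) (map_poly f p) = mup z p.
Proof.
move=> p0; have [q qz {1}->] := mup_decomposition z p0.
rewrite rmorphM rmorphXn /= map_polyXsubC mupMr ?mup_XsubCX ?eqxx //.
by rewrite fmorph_root.
Qed.

(** * Polynomials with prescribed multiplicities *)

Section Affine.

Variables (F : fieldType) (alpha beta : F).
Hypothesis alpha0 : alpha != 0.

Let A : {poly F} := alpha *: 'X + beta%:P.

Lemma horner_affine z : A.[z] = alpha * z + beta.
Proof. by rewrite hornerD hornerZ hornerX hornerC. Qed.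

Lemma size_affine : size A = 2.
Proof. by rewrite size_addl size_scale // size_polyX // ltnS size_polyC_leq1. Qed.

Lemma affine_onto z : alpha * ((z - beta) / alpha) + beta = z.
Proof. by rewrite mulrCA divff // mulr1 subrK. Qed.

Lemma mup_affine (p : {poly F}) (z : F) :
  p != 0 -> mup z (p \Po A) = mup (alpha * z + beta) p.
Proof.
move=> p0; have [q qz {1}->] := mup_decomposition (alpha * z + beta) p0.
rewrite comp_polyM rmorphXn /= comp_polyB comp_polyX comp_polyC.
have ->: A - (alpha * z + beta)%:P = alpha *: ('X - z%:P).
  by rewrite polyCD polyCM -mul_polyC /A -mul_polyC; ring.
rewrite exprZn -scalerAr scalerAl mupMr ?mup_XsubCX ?eqxx //.
by rewrite rootZ ?expf_neq0 // root_comp horner_affine.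
Qed.

Lemma deriv_affine : A^`() = alpha%:P.
Proof. by rewrite derivD derivZ derivX derivC addr0 alg_polyC. Qed.

End Affine.

Section TreePolynomials.

Variable K : numClosedFieldType.
Implicit Types (p q : {poly K}) (L : passport).

Lemma subC_neq0 (F : fieldType) (p : {poly F}) (w : F) : (1 < size p)%N -> p - w%:P != 0.
Proof.
move=> p_gt1; apply: contraTneq p_gt1 => /eqP; rewrite subr_eq0 => /eqP->.
by rewrite -leqNgt size_polyC_leq1.
Qed.

Lemma ramification_over_affine (alpha beta w : K) p l : alpha != 0 -> (1 < size p)%N ->
  ramification_over p w l ->
  ramification_over (p \Po (alpha *: 'X + beta%:P)) w l.
Proof.
move=> alpha0 p_gt1 [rs [rs_uniq rsE rs_l]]; set A := _ + _.
exists [seq (z - beta) / alpha | z <- rs].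
have inj : injective (fun z => (z - beta) / alpha).
  by move=> x y /(mulIf (invr_neq0 alpha0))/addIr.
split; first by rewrite map_inj_uniq.
  move=> z; rewrite horner_comp /A horner_affine -rsE -[RHS](mem_map inj) /=.
  by rewrite addrK mulrAC divff // mul1r.
rewrite -map_comp (eq_map (g := fun z => mup z (p - w%:P))) // => z /=.
by rewrite -[w%:P in LHS](comp_polyC w A) -comp_polyB mup_affine ?affine_onto ?subC_neq0.
Qed.

Lemma tree_polynomial_affine (alpha beta : K) L p : alpha != 0 ->
  tree_polynomial L p -> tree_polynomial L (p \Po (alpha *: 'X + beta%:P)).
Proof.
move=> alpha0 [[p_gt1 p_crit] [p_0 p_1 p_inf]].
have sz := size_comp_poly2 p (size_affine beta alpha0).
split; last by split; rewrite ?sz //; apply: ramification_over_affine.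
split=> [|z]; first by rewrite sz.
rewrite deriv_comp deriv_affine rootM rootC (negPf alpha0) orbF root_comp.
by rewrite !horner_comp; apply: p_crit.
Qed.

Lemma belyi_iso_sym p q : belyi_iso p q -> belyi_iso q p.
Proof.
case=> alpha [beta [alpha0 ->]]; exists alpha^-1, (- (beta / alpha)).
split; first by rewrite invr_eq0.
rewrite -comp_polyA [X in q \Po X](_ : _ = 'X) ?comp_polyXr //.
rewrite comp_polyD comp_polyZ comp_polyX comp_polyC scalerDr scalerA divff //.
by rewrite scale1r -addrA -mul_polyC -polyCM -polyCD mulrN mulrCA divff // mulr1 addNr addr0.
Qed.

Lemma belyi_iso_trans q p r : belyi_iso p q -> belyi_iso q r -> belyi_iso p r.
Proof.
case=> [a [b [a0 ->]]] [a' [b' [a'0 ->]]]; exists (a' * a), (a' * b + b').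
split; first by rewrite mulf_neq0.
rewrite -comp_polyA comp_polyD comp_polyZ comp_polyX comp_polyC scalerDr scalerA.
by rewrite -addrA polyCD polyCM mul_polyC.
Qed.

Lemma belyi_iso_tree L p q : belyi_iso p q -> tree_polynomial L p <-> tree_polynomial L q.
Proof.
move=> pq; split=> [|tq].
  by case: (belyi_iso_sym pq) => [a [b [a0 ->]]]; apply: tree_polynomial_affine.
by case: pq => [a [b [a0 ->]]]; apply: tree_polynomial_affine.
Qed.

Lemma poly_eq_prod_mup p (rs : seq K) : uniq rs -> (forall z, (z \in rs) = root p z) ->
  p != 0 -> p = lead_coef p *: \prod_(z <- rs) ('X - z%:P) ^+ mup z p.
Proof.
move=> rs_uniq rsE p0; have [s Dp] := closed_field_poly_normal p.
have lc0 : lead_coef p != 0 by rewrite lead_coef_eq0.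
rewrite {1}Dp; congr (_ *: _); rewrite -prodr_undup_exp_count.
have rs_s : perm_eq (undup s) rs.
  apply: uniq_perm; rewrite ?undup_uniq // => z.
  by rewrite rsE mem_undup Dp rootZ // root_prod_XsubC.
rewrite (perm_big _ rs_s) /=; apply: eq_bigr => z _; congr (_ ^+ _).
by rewrite [in RHS]Dp -mul_polyC mupMr ?mu_prod_XsubC // rootC.
Qed.

Lemma size_eq_sum_mup p (rs : seq K) : uniq rs -> (forall z, (z \in rs) = root p z) ->
  p != 0 -> size p = (\sum_(z <- rs) mup z p).+1.
Proof.
move=> rs_uniq rsE p0.
rewrite {1}(poly_eq_prod_mup rs_uniq rsE p0) size_scale ?lead_coef_eq0 //.
rewrite size_prod_seq => [|z _]; last by rewrite expf_neq0 ?polyXsubC_eq0.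
rewrite (eq_bigr (fun z => (mup z p + 1)%N)) => [|z _]; last by rewrite size_exp_XsubC addn1.
by rewrite big_split /= sum1_size -addSn addnK.
Qed.

(** This lets the points of a fibre, or the orbits of a permutation, be listed in the order of the
    passport, so that they can be named by their index. *)
Lemma perm_eq_mapP (T U : eqType) (f : T -> U) (s : seq T) (t : seq U) :
  perm_eq (map f s) t -> exists2 s', perm_eq s s' & map f s' = t.
Proof.
elim: t => [|y t IHt] in s *.
  by move/perm_size; rewrite size_map => /size0nil->; exists [::].
move=> st; have: y \in map f s by rewrite (perm_mem st) mem_head.
case/mapP=> x xs Dy; have s_rem := perm_to_rem xs.
have [|s' ss' fs'] := IHt (rem x s).
  by rewrite -(perm_cons y) -(permPr st) perm_sym Dy -map_cons perm_map.
by exists (x :: s'); rewrite /= -?fs' -?Dy // (permPl s_rem) perm_cons.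
Qed.

Lemma ramification_overP p w l : ramification_over p w l ->
  exists rs, [/\ uniq rs, forall z, (z \in rs) = root (p - w%:P) z
    & [seq mup z (p - w%:P) | z <- rs] = l].
Proof.
move=> [rs [rs_uniq rsE /perm_eq_mapP[rs' rs_rs' Dl]]]; exists rs'.
split=> // [|z]; first by rewrite -(perm_uniq rs_rs').
by rewrite -(perm_mem rs_rs') rsE /root hornerD hornerN hornerC subr_eq0.
Qed.

(** * The normal form *)

Lemma tree_normal_form p : tree_polynomial passport_321 p ->
  exists a c : K, belyi_iso p (normal_form a c).
Proof.
case=> [[p_gt1 _] [p_0 _ _]].
have [rs [rs_uniq rsE rs_mup]] := ramification_overP p_0.
have p0 := subC_neq0 0 p_gt1.
have := poly_eq_prod_mup rs_uniq rsE p0.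
case: rs rs_mup rs_uniq rsE => [|z3 [|z2 [|z1 []]]] //= [m3 m2 m1].
rewrite !inE => /and3P[/norP[z32 _] _ _] _.
rewrite !big_cons big_nil m3 m2 m1 subr0 mulr1 => ->; move: (lead_coef p) => k.
pose d := z2 - z3; have d0 : d != 0 by rewrite subr_eq0 eq_sym.
(* The substitution z -> d z + z3 sends 0 and 1 to [z3] and [z2]; each of the six linear factors
   contributes one factor [d]. *)
exists ((z1 - z3) / d), (k * d ^+ 6); apply: belyi_iso_sym; exists d, z3; split=> //.
have compX w : ('X - w%:P) \Po (d *: 'X + z3%:P) = d%:P * ('X - ((w - z3) / d)%:P).
  rewrite comp_polyB comp_polyX comp_polyC mulrBr -polyCM mulrCA divff // mulr1.
  by rewrite mul_polyC polyCB opprB addrA.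
rewrite expr1 mulrA comp_polyZ 2!comp_polyM !rmorphXn /= !compX subrr mul0r divff // polyC1.
by rewrite /normal_form subr0 -!mul_polyC polyCM polyC_exp; ring.
Qed.

Lemma deriv_normal_form (a c : K) :
  (normal_form a c)^`() =
    c%:P * ('X ^+ 2 * ('X - 1) * (6%:R *: 'X ^+ 2 - (4%:R + 5%:R * a) *: 'X + (3%:R * a)%:P)).
Proof.
rewrite /normal_form derivZ 2!derivM !deriv_exp -polyC1 !derivXsubC derivX.
rewrite -!mul_polyC polyC1 !(polyCD, polyCM, polyC_natr) !mulr_natl.
ring.
Qed.

(** A sum of indicators stays correct when [a] equals 0 or 1, so no case distinction is needed
    before those values are excluded. *)
Lemma mup_normal_form (a c z : K) : c != 0 ->
  mup z (normal_form a c) = (3 * (z == 0%R) + 2 * (z == 1%R) + (z == a))%N.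
Proof.
move=> c0; rewrite /normal_form -mul_polyC mupMr ?rootC //.
have X0 : 'X ^+ 3 = ('X - 0%:P) ^+ 3 :> {poly K} by rewrite subr0.
rewrite X0 -polyC1 mupM ?mulf_neq0 ?expf_neq0 ?polyXsubC_eq0 //.
rewrite mupM ?mulf_neq0 ?expf_neq0 ?polyXsubC_eq0 // !mup_XsubCX.
rewrite (@mup_XsubCX _ 1) !(eq_sym z).
by do 3!case: eqP => _.
Qed.

Lemma size_normal_form (a c : K) : c != 0 -> size (normal_form a c) = 7.
Proof.
move=> c0; rewrite /normal_form size_scale // size_Mmonic.
- rewrite size_XsubC size_Mmonic ?size_polyXn -?polyC1 ?size_exp_XsubC //.
  by rewrite -size_poly_eq0 size_polyXn.
  by rewrite monic_exp ?monicXsubC.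
- by rewrite -polyC1 mulf_neq0 ?expf_neq0 ?polyXsubC_eq0 ?polyX_eq0.
exact: monicXsubC.
Qed.

Lemma horner_normal_form (a c z : K) :
  (normal_form a c).[z] = c * (z ^+ 3 * (z - 1) ^+ 2 * (z - a)).
Proof. by rewrite /normal_form -polyC1 !hornerE. Qed.

(* By Vieta, [p(u) + p(v)] and [p(u) p(v)] are polynomials in [a] and [c]. *)
Lemma E1_critical_values (a c u v : K) :
  u + v = (4%:R + 5%:R * a) / 6%:R -> u * v = a / 2%:R ->
  E1 a c = 46656%:R * (2%:R - ((normal_form a c).[u] + (normal_form a c).[v])).
Proof.
move=> Ds Dq; rewrite !horner_normal_form.
pose s := u + v; pose q := u * v.
(* The four brackets are the power sums of [u], [v] of degrees 6, 5, 4, 3 in terms of [s] and [q],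
   weighted by the coefficients of the expanded normal form. *)
have -> : c * (u ^+ 3 * (u - 1) ^+ 2 * (u - a)) + c * (v ^+ 3 * (v - 1) ^+ 2 * (v - a))
  = c * ((s ^+ 6 - 6%:R * s ^+ 4 * q + 9%:R * s ^+ 2 * q ^+ 2 - 2%:R * q ^+ 3)
     - (2%:R + a) * (s ^+ 5 - 5%:R * s ^+ 3 * q + 5%:R * s * q ^+ 2)
     + (1 + 2%:R * a) * (s ^+ 4 - 4%:R * s ^+ 2 * q + 2%:R * q ^+ 2)
     - a * (s ^+ 3 - 3%:R * s * q)) by rewrite /s /q; ring.
by rewrite /s /q Ds Dq /E1; field.
Qed.

(** With s = u + v and q = uv, one has (u - 1)(v - 1) = q - s + 1 = (1 - a)/3 and (u - a)(v - a) = q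
    - as + a^2 = a(a - 1)/6, which produces the factor a^4 (a - 1)^3 / 432. *)
Lemma E2_critical_values (a c u v : K) :
  u + v = (4%:R + 5%:R * a) / 6%:R -> u * v = a / 2%:R ->
  E2 a c = 432%:R * ((normal_form a c).[u] * (normal_form a c).[v] - 1).
Proof.
move=> Ds Dq; rewrite !horner_normal_form.
pose s := u + v; pose q := u * v.
have -> : c * (u ^+ 3 * (u - 1) ^+ 2 * (u - a)) * (c * (v ^+ 3 * (v - 1) ^+ 2 * (v - a)))
  = c ^+ 2 * (q ^+ 3 * (q - s + 1) ^+ 2 * (q - a * s + a ^+ 2)) by rewrite /s /q; ring.
by rewrite /s /q Ds Dq /E2; field.
Qed.

(** [E1] fixes the sum of the two critical values at 2 and [E2] their product at 1, so both are
    roots of (T - 1)^2. *)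
Lemma E1_E2_critical_values (a c u v : K) :
  6%:R *: 'X ^+ 2 - (4%:R + 5%:R * a) *: 'X + (3%:R * a)%:P
    = 6%:R *: (('X - u%:P) * ('X - v%:P)) ->
  (E1 a c = 0 /\ E2 a c = 0 <->
   (normal_form a c).[u] = 1 /\ (normal_form a c).[v] = 1).
Proof.
move=> Duv.
have n6 : 6%:R != 0 :> K by rewrite pnatr_eq0.
have Dq : u * v = a / 2%:R.
  have := congr1 (fun p => p.[0]) Duv; rewrite !hornerE /= => E.
  apply: (mulfI n6); transitivity (3%:R * a); last by field.
  transitivity (6%:R * 0 * 0 - 0 + 3%:R * a); last by ring.
  by rewrite E; ring.
have Ds : u + v = (4%:R + 5%:R * a) / 6%:R.
  have := congr1 (fun p => p.[1]) Duv; rewrite !hornerE /= => E.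
  transitivity (1 + u * v - 6%:R * (1 - u) * (1 - v) / 6%:R); first by field.
  by rewrite -E Dq; field.
rewrite (E1_critical_values c Ds Dq) (E2_critical_values c Ds Dq).
move: (_.[u]) (_.[v]) => x y.
have nz46656 : 46656%:R != 0 :> K by rewrite pnatr_eq0.
have nz432 : 432%:R != 0 :> K by rewrite pnatr_eq0.
split=> [[/eqP]|[-> ->]]; last by split; ring.
rewrite mulf_eq0 (negPf nz46656) /= subr_eq0 => /eqP xy /eqP.
rewrite mulf_eq0 (negPf nz432) /= subr_eq0 => /eqP xy1.
have /eqP : (x - 1) ^+ 2 = 0.
  transitivity (- (x * y - 1) - (2%:R - (x + y)) * x); first by ring.
  by rewrite xy1 -xy; ring.
rewrite sqrf_eq0 subr_eq0 => /eqP Dx; split=> //.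
by rewrite -(addrK x y) [y + x]addrC -xy Dx; ring.
Qed.

Lemma size_gt1_coef_neq0 (a c : K) : (1 < size (normal_form a c))%N -> c != 0.
Proof.
by apply: contraTneq => ->; rewrite /normal_form scale0r size_poly0.
Qed.

(* The solution [c] of [E1 a c = 0], reduced modulo [quadratic_factor a]. *)
Definition normal_form_scale (F : fieldType) (a : F) : F :=
  (3475%:R * a - 2398%:R) / 24%:R.

(** [E1] is affine in [c]; modulo the quadratic factor it becomes r (c - k), and r is nonzero
    because r k = -93312. *)
Lemma E1_quadratic_root (F : numFieldType) (a c : F) : quadratic_factor a = 0 ->
  E1 a c = 0 <-> c = normal_form_scale a.
Proof.
rewrite /normal_form_scale => qa0; set k := _ / _.
(* [r] is the coefficient of [c] in [E1 a c] modulo [quadratic_factor a]. *)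
pose r := (8646912%:R * a - 5101056%:R) / 3125%:R.
have rk : r * k = - 93312%:R.
  transitivity (50080032%:R / 3125%:R * quadratic_factor a - 93312%:R).
    by rewrite /r /k /quadratic_factor; field.
  by rewrite qa0 mulr0 add0r.
have -> : E1 a c = r * (c - k).
  rewrite mulrBr rk opprK.
  (* The quartic is the quotient of the coefficient of [c] in [E1] by the quadratic factor, and [r]
     is the remainder. *)
  transitivity ((125%:R * a ^+ 4 - 140%:R * a ^+ 3 - 336%:R / 5%:R * a ^+ 2
    - 112%:R / 125%:R * a + 118816%:R / 3125%:R) * quadratic_factor a * c
    + r * c + 93312%:R); first by rewrite /r /E1 /quadratic_factor; field.
  by rewrite qa0 mulr0 mul0r add0r.
have r0 : r != 0.
  by apply/eqP => r0; move/eqP: rk; rewrite r0 mul0r eq_sym oppr_eq0 pnatr_eq0.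
split=> [/eqP|->]; last by rewrite subrr mulr0.
by rewrite mulf_eq0 (negPf r0) subr_eq0 => /eqP.
Qed.

(** Rules out the degenerate normal forms: the quadratic factor is 16 at 0 and 9 at 1, and a zero
    scale would make [E1] equal to 93312. *)
Lemma quadratic_root_neq (F : numFieldType) (a : F) : quadratic_factor a = 0 ->
  [/\ a != 0, a != 1 & normal_form_scale a != 0].
Proof.
rewrite /quadratic_factor => qa0; split; apply/eqP => a0.
- by move/eqP: qa0; rewrite a0 expr0n /= !mulr0 subr0 add0r pnatr_eq0.
- move/eqP: qa0; rewrite a0; apply/negP.
  by rewrite (_ : _ + _ = 9%:R) ?pnatr_eq0 //; ring.
move/esym/(E1_quadratic_root _ qa0)/eqP: a0.
by rewrite /E1 mulr0 add0r pnatr_eq0.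
Qed.

(** The white vertex of degree 3 is a double root w of the derivative, away from 0 and 1 where p
    vanishes, hence a double root of the quadratic factor of the derivative. Conversely, a vanishing
    discriminant provides w, [E1] forces p(w) = 1, and all other points over 1 are unramified
    because the only critical points are 0, 1 and w. *)
Lemma tree_normal_formP (a c : K) :
  tree_polynomial passport_321 (normal_form a c) <->
  quadratic_factor a = 0 /\ E1 a c = 0.
Proof.
have n6 : 6%:R != 0 :> K by rewrite pnatr_eq0.
set p := normal_form a c; split=> [[[p_gt1 _] [_ p_1 _]] | [qa0 /(E1_quadratic_root _ qa0) Dc]].
  have c0 := size_gt1_coef_neq0 p_gt1; have p10 := subC_neq0 1 p_gt1.
  have [rs [_ rsE rs_mup]] := ramification_overP p_1.
  case: rs rs_mup rsE => [|w rs] //= [mw _] /(_ w).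
  rewrite mem_head => /esym w1.
  have := mup_deriv p10 w1; rewrite mw derivB derivC subr0 deriv_normal_form => -[].
  set Q := _ + (3%:R * a)%:P => m2.
  have pw : p.[w] = 1.
    by move: w1; rewrite /root hornerD hornerN hornerC subr_eq0 => /eqP.
  have w0 : w != 0.
    apply: contra_eq_neq pw => ->.
    by rewrite horner_normal_form expr0n /= !(mul0r, mulr0) eq_sym oner_eq0.
  have wn1 : w != 1.
    apply: contra_eq_neq pw => ->.
    by rewrite horner_normal_form subrr expr0n /= !(mul0r, mulr0) eq_sym oner_eq0.
  have {m2} mQ : mup w Q = 2%N.
    rewrite m2 mupMr ?rootC // mupMr // rootM negb_or /root hornerXn.
    by rewrite expf_neq0 //= -polyC1 hornerXsubC subr_eq0.
  have Q0 : Q != 0.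
    apply/eqP => /(congr1 (fun q : {poly K} => q`_2)) /eqP.
    by rewrite /Q coefD coefB !coefZ coefXn coefX coefC coef0 /= mulr0 subr0 addr0 mulr1 pnatr_eq0.
  have Qw : root Q w.
    by apply: contra_eqT mQ => /mupNroot->.
  have := mup_deriv Q0 Qw; rewrite mQ => -[mQ'].
  have : root Q^`() w by apply: contra_eqT mQ' => /mupNroot->.
  rewrite /Q !derivE /root !hornerE /= => /eqP Q'w.
  move: Qw; rewrite /Q /root !hornerE /= => /eqP Qw.
  have Dw : w + w = (4%:R + 5%:R * a) / 6%:R.
    apply: (mulfI n6); apply/eqP; rewrite -subr_eq0; apply/eqP.
    by rewrite mulrCA divff // mulr1.
  have Dq : w * w = a / 2%:R.
    transitivity ((6%:R * w * w - (4%:R + 5%:R * a) * w + 3%:R * a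
      - (6%:R * (w + w) - (4%:R + 5%:R * a)) * w) / - 6%:R + a / 2%:R); first by field.
    by rewrite Qw Q'w mul0r subrr mul0r add0r.
  split; last by rewrite (E1_critical_values c Dw Dq) -/p pw; ring.
  rewrite /quadratic_factor.
  (* This is 36 times the discriminant s^2 - 4q of the monic quadratic, where s = w + w and q = w
     w. *)
  transitivity (36%:R * ((4%:R + 5%:R * a) / 6%:R) ^+ 2 - 72%:R * a); first by field.
  rewrite -Dw; transitivity (36%:R * 4%:R * (w * w) - 72%:R * a); first by ring.
  by rewrite Dq; field.
have [a0 a1 c0] := quadratic_root_neq qa0; rewrite -Dc in c0.
pose w : K := (4%:R + 5%:R * a) / 12%:R.
have Dw : w + w = (4%:R + 5%:R * a) / 6%:R by rewrite /w; field.
have Dq : w * w = a / 2%:R.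
  transitivity (quadratic_factor a / 144%:R + a / 2%:R).
    by rewrite /w /quadratic_factor; field.
  by rewrite qa0 mul0r add0r.
clearbody w.
(* Taking u = v = w in [E1_critical_values] gives 46656 (2 - 2 p(w)) = 0. *)
have pw : p.[w] = 1.
  have E1ac : E1 a c = 0 by apply/(E1_quadratic_root c qa0).
  move/eqP: (E1_critical_values c Dw Dq).
  rewrite E1ac eq_sym mulf_eq0 pnatr_eq0 /= -/p -mulr2n -(mulr_natl p.[w]).
  rewrite -[X in X - _]mulr1 -mulrBr.
  by rewrite mulf_eq0 pnatr_eq0 /= subr_eq0 => /eqP.
have Dp' : p^`() = (c * 6%:R)%:P * ('X ^+ 2 * ('X - 1)) * ('X - w%:P) ^+ 2.
  rewrite deriv_normal_form -!mul_polyC.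
  have -> : 4%:R + 5%:R * a = 6%:R * (w + w) by rewrite Dw mulrCA divff // mulr1.
  have -> : 3%:R * a = 6%:R * (w * w) by rewrite Dq; field.
  by rewrite !(polyCD, polyCM); ring.
have sz_p : size p = 7 by apply: size_normal_form.
have p_gt1 : (1 < size p)%N by rewrite sz_p.
have p10 := subC_neq0 1 p_gt1.
have p_0 : p.[0] = 0 by rewrite horner_normal_form expr0n /= !(mul0r, mulr0).
have p_1 : p.[1] = 0 by rewrite horner_normal_form subrr expr0n /= !(mul0r, mulr0).
have w0 : w != 0 by apply: contra_eq_neq pw => ->; rewrite p_0 eq_sym oner_eq0.
have w1 : w != 1 by apply: contra_eq_neq pw => ->; rewrite p_1 eq_sym oner_eq0.
have root_p' z : root p^`() z = (z == 0) || (z == 1) || (z == w).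
  rewrite /root Dp' -polyC1 hornerM horner_exp hornerXsubC hornerM hornerC hornerM.
  by rewrite hornerXn hornerXsubC !mulf_eq0 !subr_eq0 !orbb (negPf c0) pnatr_eq0.
split; first by split=> // z; rewrite root_p' => /orP[/orP[]|] /eqP->; auto.
split; last by rewrite sz_p.
  exists [:: 0; 1; a]; rewrite subr0 /= !mup_normal_form // !eqxx !(eq_sym _ a).
  split=> [|z|]; rewrite ?inE 1?eq_sym ?oner_eq0 ?(negPf a0) ?(negPf a1) //=.
    by rewrite !(eq_sym _ a) a0 a1.
  by rewrite (eq_sym 0) horner_normal_form !mulf_eq0 !subr_eq0 !orbb (negPf c0) orbA.
(* The fibre over 1 is the set of distinct roots of p - 1; [mup_deriv] reads their multiplicities
   off the derivative. *)
have [s Ds] := closed_field_poly_normal (p - 1%:P).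
have lc0 : lead_coef (p - 1%:P) != 0 by rewrite lead_coef_eq0.
pose rs := undup s; have rs_uniq : uniq rs by apply: undup_uniq.
have rsE z : (z \in rs) = root (p - 1%:P) z.
  by rewrite mem_undup Ds rootZ // root_prod_XsubC.
have root1 z : root (p - 1%:P) z = (p.[z] == 1).
  by rewrite /root hornerD hornerN hornerC subr_eq0.
have w_rs : w \in rs by rewrite rsE root1 pw.
have mupE z : z \in rs -> mup z (p - 1%:P) = if z == w then 3 else 1%N.
  move=> z_rs; rewrite mup_deriv -?rsE // derivB derivC subr0.
  have pz : p.[z] = 1 by apply/eqP; rewrite -root1 -rsE.
  case: eqP => [->|/eqP zw].
    rewrite Dp' mupMr ?mup_XsubCX ?eqxx // /root -polyC1 hornerM hornerC.
    rewrite hornerM hornerXn hornerXsubC.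
    by rewrite !mulf_eq0 !orbb !negb_or c0 pnatr_eq0 subr_eq0 w0 w1.
  rewrite mupNroot // root_p' (negPf zw) orbF.
  by apply/norP; split; apply: contra_eq_neq pz => ->; rewrite ?p_0 ?p_1 eq_sym oner_eq0.
exists (w :: rem w rs); have w_rem := perm_to_rem w_rs; rewrite perm_sym in w_rem.
have mem_rem z : (z \in w :: rem w rs) = (z \in rs) by rewrite (perm_mem w_rem).
have Drs : [seq mup z (p - 1%:P) | z <- w :: rem w rs] = 3%N :: nseq (size (rem w rs)) 1%N.
  rewrite /= mupE // eqxx; congr (_ :: _).
  rewrite -(size_map (fun z => mup z (p - 1%:P))); apply/all_pred1P.
  rewrite all_map; apply/allP => z /=; rewrite mem_rem_uniq // inE => /andP[zw z_rs].
  by rewrite mupE // (negPf zw).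
split; [by rewrite (perm_uniq w_rem) | by move=> z; rewrite mem_rem rsE root1 |].
rewrite Drs.
(* The multiplicities add up to the degree 6, so next to the 3 at [w] there are exactly three simple
   points. *)
have := size_eq_sum_mup rs_uniq rsE p10.
rewrite size_addl ?size_opp ?size_polyC ?sz_p ?oner_eq0 // -(perm_big _ w_rem) /=.
rewrite -(big_map (fun z => mup z (p - 1%:P)) xpredT id) Drs big_cons big_nseq.
rewrite iter_addn_0 mul1n => sz_rem.
by have <- : 3%N = size (rem w rs) by case: sz_rem.
Qed.

(** An affine isomorphism preserves multiplicities, hence fixes 0 (the only root of multiplicity 3)
    and 1 (the only one of multiplicity 2). It is therefore the identity and matches the simple
    roots. *)
Lemma normal_form_unique (a c a' c' : K) :
  tree_polynomial passport_321 (normal_form a c) ->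
  tree_polynomial passport_321 (normal_form a' c') ->
  belyi_iso (normal_form a c) (normal_form a' c') -> a = a' /\ c = c'.
Proof.
move=> /tree_normal_formP[qa /(E1_quadratic_root _ qa) Dc].
move=> /tree_normal_formP[qa' /(E1_quadratic_root _ qa') Dc'].
have [a0 a1 c0] := quadratic_root_neq qa; rewrite -Dc in c0.
have [a'0 a'1 c'0] := quadratic_root_neq qa'; rewrite -Dc' in c'0.
case=> alpha [beta [alpha0 Dp]].
suffices Da : a = a' by split; rewrite // Dc Dc' Da.
have mupE z : (3 * (z == 0%R) + 2 * (z == 1%R) + (z == a) =
    3 * ((alpha * z + beta)%R == 0%R) + 2 * ((alpha * z + beta)%R == 1%R)
    + ((alpha * z + beta)%R == a'))%N.
  rewrite -(mup_normal_form _ _ c0) -(mup_normal_form _ _ c'0) Dp mup_affine //.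
  by rewrite -size_poly_eq0 size_normal_form.
have b0 : beta = 0.
  have := mupE 0; rewrite mulr0 add0r eqxx !(eq_sym 0) oner_eq0 (negPf a0).
  have [-> //|_] := eqVneq beta 0.
  by case: (eqVneq beta 1) => [->|_]; rewrite ?(eq_sym 1) ?(negPf a'1) //; case: eqP.
rewrite b0 in mupE.
have al1 : alpha = 1.
  have := mupE 1; rewrite mulr1 addr0 eqxx oner_eq0 (negPf alpha0) (eq_sym 1) (negPf a1).
  by have [-> //|_] := eqVneq alpha 1; case: eqP.
have := mupE a; rewrite al1 mul1r addr0 (negPf a0) (negPf a1) eqxx.
by case: eqP.
Qed.

End TreePolynomials.

(** * Change of field *)

Section ChangeOfField.

Variables (F K : numClosedFieldType) (f : {rmorphism F -> K}).
Implicit Types (p q : {poly F}) (L : passport).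

(** Over the closed field [F] the polynomial already splits, so no new root can appear in [K]. *)
Lemma root_map_poly_closed p (y : K) : p != 0 -> root (map_poly f p) y ->
  exists2 x, root p x & y = f x.
Proof.
move=> p0; have [s Dp] := closed_field_poly_normal p.
have lc0 : lead_coef p != 0 by rewrite lead_coef_eq0.
rewrite Dp map_polyZ /= rootZ ?fmorph_eq0 // map_prod_XsubC.
rewrite -(big_map f xpredT (fun z => 'X - z%:P)) root_prod_XsubC => /mapP[x xs ->].
by exists x; rewrite // rootZ // root_prod_XsubC.
Qed.

Lemma map_poly_subC p (w : F) : map_poly f p - (f w)%:P = map_poly f (p - w%:P).
Proof. by rewrite rmorphB /= map_polyC. Qed.

Lemma ramification_over_map p (w : F) l : (1 < size p)%N ->
  ramification_over (map_poly f p) (f w) l <-> ramification_over p w l.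
Proof.
move=> p_gt1; have pw0 := subC_neq0 w p_gt1.
split=> [[rs [rs_uniq rsE rs_l]] | [rs [rs_uniq rsE rs_l]]]; last first.
  exists (map f rs); split; first by rewrite map_inj_uniq //; apply: fmorph_inj.
    move=> z; apply/mapP/eqP => [[x]|pz].
      by rewrite rsE => /eqP px ->; rewrite horner_map px.
    have [||x px ->] := @root_map_poly_closed (p - w%:P) z => //.
      by rewrite -map_poly_subC /root hornerD hornerN hornerC pz subrr.
    by exists x; rewrite // rsE -subr_eq0; rewrite /root hornerD hornerN hornerC in px.
  rewrite -map_comp (eq_map (g := fun z => mup z (p - w%:P))) // => z /=.
  by rewrite map_poly_subC mup_map.
have rs_im z : z \in rs -> exists x, z == f x.
  rewrite rsE => /eqP pz; have [||x _ ->] := @root_map_poly_closed (p - w%:P) z => //.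
    by rewrite -map_poly_subC /root hornerD hornerN hornerC pz subrr.
  by exists x.
have [s Drs] : exists s, rs = map f s.
  elim: rs rs_im {rs_uniq rsE rs_l} => [|z rs IHrs] rs_im; first by exists [::].
  have [x /eqP->] := rs_im z (mem_head z rs).
  have [|s ->] := IHrs; last by exists (x :: s).
  by move=> y y_rs; apply: rs_im; rewrite inE y_rs orbT.
exists s; split; first by rewrite Drs in rs_uniq; apply: map_uniq rs_uniq.
  move=> z; rewrite -(mem_map (fmorph_inj f)) -Drs rsE horner_map.
  by rewrite (inj_eq (fmorph_inj f)).
move: rs_l; rewrite Drs -map_comp (eq_map (g := fun z => mup z (p - w%:P))) // => z /=.
by rewrite map_poly_subC mup_map.
Qed.

(** Used to descend the tree property from the large field to a model over [algC]. *)
Lemma tree_polynomial_map L p : tree_polynomial L (map_poly f p) <-> tree_polynomial L p.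
Proof.
have crit z : root (map_poly f p)^`() (f z) = root p^`() z.
  by rewrite deriv_map fmorph_root.
have val z w : (map_poly f p).[f z] = f w <-> p.[z] = w.
  by rewrite horner_map; split=> [/fmorph_inj|->].
have ram := @ramification_over_map p.
rewrite /tree_polynomial /polynomial_belyi_map /has_passport size_map_poly.
split=> -[[p_gt1 p_crit] [p_0 p_1 p_inf]]; move: p_0 p_1.
  rewrite -(rmorph0 f) -(rmorph1 f) !ram // => p_0 p_1; split=> //; split=> // z.
  rewrite -crit => /p_crit; rewrite -(rmorph0 f) -(rmorph1 f) !val.
  by case; auto.
rewrite -!ram // rmorph0 rmorph1 => p_0 p_1; split=> //; split=> // y.
(* The top coefficient of the derivative is the degree times the leading coefficient, nonzero in
   characteristic 0. *)
have p'0 : p^`() != 0.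
  apply/eqP => /(congr1 (fun q : {poly F} => q`_(size p).-2)) /eqP.
  rewrite coef_deriv coef0 mulrn_eq0 /= -[_.+1]/((size p).-2.+1).
  have -> : (size p).-2.+1 = (size p).-1 by case: (size p) p_gt1 => [|[]].
  by rewrite -/(lead_coef p) lead_coef_eq0 -size_poly_eq0; case: (size p) p_gt1.
rewrite deriv_map => /(root_map_poly_closed p'0)[x /p_crit p_x ->].
by rewrite -(rmorph0 f) -(rmorph1 f) !val.
Qed.

Lemma belyi_iso_map p q : belyi_iso p q -> belyi_iso (map_poly f p) (map_poly f q).
Proof.
case=> a [b [a0 ->]]; exists (f a), (f b); rewrite fmorph_eq0; split=> //.
by rewrite map_comp_poly rmorphD /= map_polyZ /= map_polyX map_polyC.
Qed.

Lemma normal_form_map (a c : F) :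
  map_poly f (normal_form a c) = normal_form (f a) (f c).
Proof.
rewrite /normal_form map_polyZ /= 2!rmorphM /= !rmorphXn /= !rmorphB /=.
by rewrite rmorph1 map_polyX map_polyC.
Qed.

End ChangeOfField.

Lemma normal_form_scale_map (F K : fieldType) (f : {rmorphism F -> K}) (a : F) :
  f (normal_form_scale a) = normal_form_scale (f a).
Proof. by rewrite /normal_form_scale fmorph_div rmorphB rmorphM !rmorph_nat. Qed.

Lemma quadratic_factor_roots (K : numClosedFieldType) (a : K) :
  quadratic_factor a = 0 <->
  a = (16%:R + 12%:R * 'i) / 25%:R \/ a = (16%:R - 12%:R * 'i) / 25%:R.
Proof.
have i2 : 'i * 'i = -1 :> K by rewrite -expr2 sqrCi.
have n25 : 25%:R != 0 :> K by rewrite pnatr_eq0.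
have -> : quadratic_factor a =
    25%:R * ((a - (16%:R + 12%:R * 'i) / 25%:R) * (a - (16%:R - 12%:R * 'i) / 25%:R)).
  (* The constant 16 is written as (16^2 - 12^2 i^2)/25 to expose the conjugate roots. *)
  transitivity (25%:R * a ^+ 2 - 32%:R * a + (256%:R - 144%:R * ('i * 'i)) / 25%:R).
    by rewrite i2 /quadratic_factor; field.
  by field.
split=> [/eqP|[->|->]]; last 2 first.
- by rewrite subrr mul0r mulr0.
- by rewrite subrr !mulr0.
by rewrite !mulf_eq0 (negPf n25) /= !subr_eq0 => /orP[]/eqP; auto.
Qed.

Lemma quadratic_roots_neq (K : numClosedFieldType) :
  (16%:R + 12%:R * 'i) / 25%:R != (16%:R - 12%:R * 'i) / 25%:R :> K.
Proof.
rewrite -subr_eq0 (_ : _ - _ = 24%:R / 25%:R * 'i); last by field.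
by rewrite !mulf_eq0 invr_eq0 !pnatr_eq0 /= neq0Ci.
Qed.

(** * The two plane trees *)

Section Cycles.

Variable (T : finType).
Implicit Types (s : {perm T}) (x y : T) (c : seq T).

Lemma mem_porbit_fconnect s x y : (y \in porbit s x) = fconnect s x y.
Proof.
apply/porbitP/idP => [[i ->]|/iter_findex<-]; first by rewrite permX fconnect_iter.
by exists (findex s x y); rewrite permX.
Qed.

Lemma porbit_fcycle s c x : fcycle s c -> x \in c -> porbit s x = [set y in c].
Proof.
move=> s_c c_x; apply/setP => y.
by rewrite mem_porbit_fconnect (fconnect_cycle s_c c_x) inE.
Qed.

(** Nonempty disjoint cycles that cover [T] are all the orbits, so a cycle type is computed by
    exhibiting cycles. *)
Lemma enum_porbits_fcycle s (cs : seq (seq T)) :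
    all (fcycle s) cs -> [::] \notin cs -> uniq (flatten cs) ->
    (forall x, x \in flatten cs) ->
  perm_eq (enum (porbits s)) [seq [set y in c] | c <- cs].
Proof.
move=> /allP s_cs cs_nil cs_uniq cs_full; apply: uniq_perm; first exact: enum_uniq.
  elim: cs {cs_full s_cs} cs_nil cs_uniq => //= c cs IHcs.
  rewrite inE negb_or eq_sym cat_uniq => /andP[c_nil cs_nil] /and3P[_ c_cs cs_uniq].
  rewrite IHcs // andbT; apply/mapP => -[c' cs_c' /setP cc'].
  case: c c_nil c_cs cc' => // x c _ /hasPn x_cs /(_ x); rewrite !inE eqxx /= => /esym c'x.
  have /x_cs : x \in flatten cs by apply/flattenP; exists c'.
  by rewrite /= mem_head.
move=> d; rewrite mem_enum; apply/imsetP/mapP => [[x _ ->]|[c cs_c ->]].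
  have /flattenP[c cs_c c_x] := cs_full x; exists c => //.
  exact: porbit_fcycle (s_cs c cs_c) c_x.
case: c cs_c => [|x c] cs_c; first by rewrite cs_c in cs_nil.
by exists x => //; rewrite (porbit_fcycle (s_cs _ cs_c)) ?mem_head.
Qed.

End Cycles.

Lemma cycle_type_fcycle (d : nat) (s : 'S_d) (cs : seq (seq 'I_d)) :
    all (fcycle s) cs -> [::] \notin cs -> uniq (flatten cs) ->
    (forall x, x \in flatten cs) ->
  perm_eq (cycle_type s) (map size cs) /\ #|porbits s| = size cs.
Proof.
move=> s_cs cs_nil cs_uniq cs_full.
have cs_enum := enum_porbits_fcycle s_cs cs_nil cs_uniq cs_full.
split; last by rewrite cardE (perm_size cs_enum) size_map.
apply: perm_trans (perm_map _ cs_enum) _; rewrite -map_comp.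
suffices /eq_in_map-> : {in cs, (fun c : seq 'I_d => #|[set y in c]|) =1 size} by [].
move=> c cs_c; rewrite cardsE; apply/card_uniqP.
elim: cs cs_c cs_uniq {s_cs cs_nil cs_full cs_enum} => //= c' cs IHcs.
by rewrite inE cat_uniq => /predU1P[-> /and3P[]|/IHcs-IHc /and3P[_ _ /IHc]].
Qed.

Local Notation ord6 k := (@Ordinal 6 k isT).

Definition perm_of_tuple (d : nat) (l : d.-tuple 'I_d) (l_uniq : uniq l) : 'S_d :=
  perm (elimT (tuple_uniqP l) l_uniq).

(* Edges 0, 1, 2 end at the black vertex of degree 3, edges 3, 4 at the one   *)
(* of degree 2 and edge 5 at the leaf; edges 0, 3, 5 meet at the white vertex *)
(* of degree 3, in one of the two cyclic orders.                              *)
Definition black_rotation : 'S_6 := @perm_of_tuple 6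
  [tuple ord6 1; ord6 2; ord6 0; ord6 4; ord6 3; ord6 5] isT.

Definition white_rotation : 'S_6 := @perm_of_tuple 6
  [tuple ord6 3; ord6 1; ord6 2; ord6 5; ord6 4; ord6 0] isT.

Definition mirror_white_rotation : 'S_6 := @perm_of_tuple 6
  [tuple ord6 5; ord6 1; ord6 2; ord6 0; ord6 4; ord6 3] isT.

Lemma ord6P (P : 'I_6 -> Prop) :
  P (ord6 0) -> P (ord6 1) -> P (ord6 2) -> P (ord6 3) -> P (ord6 4) -> P (ord6 5) ->
  forall i, P i.
Proof.
by move=> P0 P1 P2 P3 P4 P5 [[|[|[|[|[|[|]]]]]]] // lt_i; rewrite (bool_irrelevance lt_i isT).
Qed.

(** The two trees share the black rotation. The single face [c6] already gives transitivity, since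
    the product of the rotations lies in the group they generate; the vertex count is 3 + 4 = 6 +
    1. *)
Lemma plane_tree_of_cycles (w : 'S_6) (c3 c6 : seq 'I_6) :
    fcycle w c3 -> size c3 = 3%N ->
    fcycle (black_rotation * w)%g c6 -> size c6 = 6%N -> uniq c6 ->
    uniq c3 -> (forall x, x \notin c3 -> w x = x) ->
  plane_tree (black_rotation, w) /\ tree_has_passport passport_321 (black_rotation, w).
Proof.
move=> w_c3 sz_c3 bw_c6 sz_c6 c6_uniq c3_uniq w_fix.
have c6_full x : x \in c6.
  have : c6 =i 'I_6.
    by apply/subset_cardP; [rewrite card_ord (card_uniqP c6_uniq) | apply/subsetP].
  by move->.
have [b_type b_card] : perm_eq (cycle_type black_rotation) [:: 3; 2; 1]%N
    /\ #|porbits black_rotation| = 3%N.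
  pose cs := [:: [:: ord6 0; ord6 1; ord6 2]; [:: ord6 3; ord6 4]; [:: ord6 5]].
  apply: (@cycle_type_fcycle _ _ cs) => //.
    by rewrite /= !permE.
  by elim/ord6P.
pose fixed := enum [predC c3].
have [w_type w_card] : perm_eq (cycle_type w) [:: 3; 1; 1; 1]%N /\ #|porbits w| = 4%N.
  have sz_fixed : size fixed = 3%N.
    apply/eqP; rewrite -cardE -(eqn_add2l 3) -{1}sz_c3 -(card_uniqP c3_uniq) cardC.
    by rewrite card_ord.
  have Dcs : map size (c3 :: [seq [:: x] | x <- fixed]) = [:: 3; 1; 1; 1]%N.
    rewrite /= sz_c3 -map_comp.
    by case: fixed sz_fixed => [|? [|? [|? []]]].
  have Esz : size (c3 :: [seq [:: x] | x <- fixed]) = 4%N by rewrite /= size_map sz_fixed.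
  rewrite -Dcs; suffices [wt ->] :
    perm_eq (cycle_type w) (map size (c3 :: [seq [:: x] | x <- fixed]))
    /\ #|porbits w| = size (c3 :: [seq [:: x] | x <- fixed]) by [].
  apply: cycle_type_fcycle => [||| x].
  - rewrite /= w_c3 all_map; apply/allP => x; rewrite mem_enum => x_c3 /=.
    by rewrite w_fix ?eqxx.
  - rewrite inE; apply/norP; split; last by apply/mapP => -[].
    by apply/eqP => c3_nil; rewrite -c3_nil in sz_c3.
  - rewrite /= flatten_map1 map_id cat_uniq c3_uniq enum_uniq andbT /=.
    by apply/hasPn => x; rewrite mem_enum.
  by rewrite /= flatten_map1 map_id mem_cat mem_enum inE orbN.
have bw_type : perm_eq (cycle_type (black_rotation * w)%g) [:: 6]%N.
  suffices [] : perm_eq (cycle_type (black_rotation * w)%g) (map size [:: c6])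
    /\ #|porbits (black_rotation * w)%g| = size [:: c6] by rewrite /= sz_c6.
  apply: (@cycle_type_fcycle _ _ [:: c6]) => [|||x] /=.
  - by rewrite bw_c6.
  - by rewrite inE; apply/eqP => c6_nil; rewrite -c6_nil in sz_c6.
  - by rewrite cats0.
  by rewrite cats0.
split; last by [].
split; last by rewrite b_card w_card.
apply/imsetP; exists (ord6 0); rewrite ?inE //; apply/esym/eqP; rewrite eqEsubset subsetT.
apply/subsetP => y _.
have : y \in porbit (black_rotation * w)%g (ord6 0) by rewrite (porbit_fcycle bw_c6) ?inE.
rewrite porbitE; apply: subsetP; apply: imsetS; rewrite cycle_subG groupM ?mem_gen //.
  by rewrite !inE eqxx.
by rewrite !inE eqxx orbT.
Qed.

Lemma plane_tree_white :
  plane_tree (black_rotation, white_rotation) /\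
  tree_has_passport passport_321 (black_rotation, white_rotation).
Proof.
apply: (@plane_tree_of_cycles _ [:: ord6 0; ord6 3; ord6 5]
  [:: ord6 0; ord6 1; ord6 2; ord6 3; ord6 4; ord6 5]) => //.
- by rewrite /= !permE.
- by rewrite /= !permM !permE.
by elim/ord6P => // _; rewrite permE.
Qed.

Lemma plane_tree_mirror_white :
  plane_tree (black_rotation, mirror_white_rotation) /\
  tree_has_passport passport_321 (black_rotation, mirror_white_rotation).
Proof.
apply: (@plane_tree_of_cycles _ [:: ord6 0; ord6 5; ord6 3]
  [:: ord6 0; ord6 1; ord6 2; ord6 5; ord6 3; ord6 4]) => //.
- by rewrite /= !permE.
- by rewrite /= !permM !permE.
by elim/ord6P => // _; rewrite permE.
Qed.

(** An isomorphism fixes the unique black leaf, edge 5; following the white rotations it sends edge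
    0 to edge 3, and so would map a black 3-cycle onto a 2-cycle. *)
Lemma mirror_trees_not_iso :
  ~ tree_iso (black_rotation, white_rotation) (black_rotation, mirror_white_rotation).
Proof.
case=> g [/= Db Dw].
have gb i : g (black_rotation i) = black_rotation (g i) by rewrite [in RHS]Db permJ.
have gw i : g (white_rotation i) = mirror_white_rotation (g i) by rewrite Dw permJ.
have b_fix i : (black_rotation i == i) = (i == ord6 5) by elim/ord6P: i; rewrite permE.
have g5 : g (ord6 5) = ord6 5.
  by apply/eqP; rewrite -b_fix -gb; apply/eqP; congr (g _); apply/eqP; rewrite b_fix.
have g0 : g (ord6 0) = ord6 3.
  have -> : ord6 0 = white_rotation (ord6 5) by rewrite permE; apply: val_inj.
  by rewrite gw g5 permE; apply: val_inj.
have g1 : g (ord6 1) = ord6 4.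
  have -> : ord6 1 = black_rotation (ord6 0) by rewrite permE; apply: val_inj.
  by rewrite gb g0 permE; apply: val_inj.
have : g (ord6 2) = g (ord6 0).
  have -> : ord6 2 = black_rotation (ord6 1) by rewrite permE; apply: val_inj.
  by rewrite gb g1 g0 permE; apply: val_inj.
by move/perm_inj.
Qed.

Lemma cycle_type_orbits (d : nat) (s : 'S_d) (l : seq nat) : perm_eq (cycle_type s) l ->
  exists2 cs, perm_eq (enum (porbits s)) cs & [seq #|pred_of_set c| | c <- cs] = l.
Proof. by move/perm_eq_mapP. Qed.

Lemma porbit_card1 (T : finType) (s : {perm T}) x : #|porbit s x| = 1%N -> s x = x.
Proof. by move=> s_x; have := iter_porbit s x; rewrite s_x. Qed.

(* An orbit of the black rotation that avoided the only nontrivial cycle of   *)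
(* the white rotation would be a union of connected components.               *)
Lemma black_orbit_meets_white_cycle (d : nat) (s : 'S_d * 'S_d) (D : {set 'I_d}) (x : 'I_d) :
    [transitive <<[set s.1; s.2]>>%g, on [set: 'I_d] | 'P] ->
    (forall y, y \notin D -> s.2 y = y) -> (#|porbit s.1 x| < d)%N ->
  exists2 y, y \in porbit s.1 x & y \in D.
Proof.
move=> s_trans s2_fix card_x; apply/exists_inP; apply: contraLR card_x.
rewrite negb_exists_in => /forall_inP x_D; rewrite -leqNgt.
have /acts_sub_orbit : [acts <<[set s.1; s.2]>>%g, on porbit s.1 x | 'P].
  rewrite gen_subG; apply/subsetP => t; rewrite !inE => t_s; apply/subsetP => y y_x.
  rewrite inE /=; case/orP: t_s => /eqP->; last by rewrite apermE s2_fix ?x_D.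
  move: y_x; rewrite apermE -!eq_porbit_mem => /eqP<-.
  by rewrite eq_porbit_mem; have := mem_porbit s.1 1 y; rewrite expg1.
move/(_ x); rewrite porbit_id (atransP s_trans) ?inE // => /subset_leq_card.
by rewrite cardsT card_ord.
Qed.

(** The white 3-cycle [D] meets each black cycle, hence in exactly one edge each: [x], [y], [z].
    Running through the black cycles from these edges labels all six edges, and only the cyclic
    order of [x], [y], [z] is left free. *)
Lemma plane_tree_321_classification (s : 'S_6 * 'S_6) :
  plane_tree s -> tree_has_passport passport_321 s ->
  tree_iso s (black_rotation, white_rotation)
  \/ tree_iso s (black_rotation, mirror_white_rotation).
Proof.
case=> s_trans _ [/cycle_type_orbits[cs1 Ecs1 cs1_l] /cycle_type_orbits[cs2 Ecs2 cs2_l] _].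
case: cs1 Ecs1 cs1_l => [|c3 [|c2 [|c1 []]]] //= Ecs1 [c3_3 c2_2 c1_1].
case: cs2 Ecs2 cs2_l => [|D [|e1 [|e2 [|e3 []]]]] //= Ecs2 [D_3 e1_1 e2_1 e3_1].
have porb1 x : porbit s.1 x \in [:: c3; c2; c1].
  by rewrite -(perm_mem Ecs1) mem_enum imset_f.
have porb2 x : porbit s.2 x \in [:: D; e1; e2; e3].
  by rewrite -(perm_mem Ecs2) mem_enum imset_f.
have s2_fix y : y \notin D -> s.2 y = y.
  move=> yD; apply: porbit_card1; have := porb2 y; have := porbit_id s.2 y.
  rewrite !inE => y_y /or4P[] /eqP Ey; rewrite Ey ?e1_1 ?e2_1 ?e3_1 //=.
  by rewrite Ey (negPf yD) in y_y.
have meets c : c \in [:: c3; c2; c1] -> (#|c| < 6)%N ->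
    exists2 y, y \in D & porbit s.1 y = c.
  rewrite -(perm_mem Ecs1) mem_enum => /imsetP[x _ ->] card_x.
  have [y y_x yD] := black_orbit_meets_white_cycle s_trans s2_fix card_x.
  by exists y => //; apply/eqP; rewrite eq_porbit_mem.
have [|| x xD Ex] := meets c3; rewrite ?inE ?eqxx ?c3_3 //.
have [|| y yD Ey] := meets c2; rewrite ?inE ?eqxx ?orbT ?c2_2 //.
have [|| z zD Ez] := meets c1; rewrite ?inE ?eqxx ?orbT ?c1_1 //.
have porb_iter i a : porbit s.1 (iter i s.1 a) = porbit s.1 a.
  by apply/eqP; rewrite eq_porbit_mem -permX mem_porbit.
have porb_traject a b n : a \in traject s.1 b n -> porbit s.1 a = porbit s.1 b.
  by case/trajectP=> i _ ->.
have c32 : c3 != c2 by apply: contra_eq_neq c3_3 => ->; rewrite c2_2.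
have c31 : c3 != c1 by apply: contra_eq_neq c3_3 => ->; rewrite c1_1.
have c21 : c2 != c1 by apply: contra_eq_neq c2_2 => ->; rewrite c1_1.
have x_uniq : uniq (traject s.1 x 3) by have := uniq_traject_porbit s.1 x; rewrite Ex c3_3.
have y_uniq : uniq (traject s.1 y 2) by have := uniq_traject_porbit s.1 y; rewrite Ey c2_2.
have s1x : s.1 (s.1 (s.1 x)) = x by have := iter_porbit s.1 x; rewrite Ex c3_3.
have s1y : s.1 (s.1 y) = y by have := iter_porbit s.1 y; rewrite Ey c2_2.
have s1z : s.1 z = z by have := iter_porbit s.1 z; rewrite Ez c1_1.
have t_uniq : uniq [tuple x; s.1 x; s.1 (s.1 x); y; s.1 y; z].
  change (uniq (traject s.1 x 3 ++ traject s.1 y 2 ++ [:: z])).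
  rewrite cat_uniq x_uniq.
  rewrite cat_uniq y_uniq andTb andTb !andbT; apply/andP; split; apply/hasPn => a.
    rewrite mem_cat mem_seq1 => a_yz; apply/negP => /porb_traject a_x.
    case/orP: a_yz => [/porb_traject a_y | /eqP Ea].
      by case/eqP: c32; rewrite -Ex -Ey -a_x.
    by case/eqP: c31; rewrite -Ex -Ez -a_x Ea.
  rewrite mem_seq1 => /eqP->; apply/negP => /porb_traject z_y.
  by case/eqP: c21; rewrite -Ez z_y.
pose g := perm_of_tuple t_uniq.
have iso_of (w : 'S_6) : (forall i, s.2 (g i) = g (w i)) -> tree_iso s (black_rotation, w).
  move=> s2g; exists g^-1%g; split; apply/permP => i /=; rewrite conjgE invgK !permM.
    apply: (@perm_inj _ g); rewrite permKV.
    by elim/ord6P: i; rewrite !permE /= ?permE.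
  by apply: (@perm_inj _ g); rewrite permKV s2g.
have xyz_uniq : uniq [:: x; y; z].
  rewrite /= !inE negb_or -andbA; apply/and4P; split=> //.
  - by apply: contra_neq c32 => xy; rewrite -Ex -Ey xy.
  - by apply: contra_neq c31 => xz; rewrite -Ex -Ez xz.
  by apply: contra_neq c21 => yz; rewrite -Ey -Ez yz.
(* Both sets have three elements and one contains the other. *)
have D_xyz a : (a \in D) = (a \in [:: x; y; z]).
  apply/esym; move: a; apply/subset_cardP; first by rewrite D_3; apply/card_uniqP.
  by apply/subsetP => a; rewrite !inE => /or3P[]/eqP->.
have ED : porbit s.2 x = D.
  have : D \in enum (porbits s.2) by rewrite (perm_mem Ecs2) mem_head.
  rewrite mem_enum => /imsetP[a _ Da].
  by apply/eqP; rewrite Da eq_porbit_mem -Da.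
have s2x : s.2 (s.2 (s.2 x)) = x by have := iter_porbit s.2 x; rewrite ED D_3.
have x2_uniq : uniq (traject s.2 x 3) by have := uniq_traject_porbit s.2 x; rewrite ED D_3.
have Dx i : iter i s.2 x \in [:: x; y; z] by rewrite -D_xyz -ED -permX mem_porbit.
have [gx [gy gz]] : g (ord6 0) = x /\ g (ord6 3) = y /\ g (ord6 5) = z.
  by rewrite !permE.
have s2_off i : i \notin [:: ord6 0; ord6 3; ord6 5] -> s.2 (g i) = g i.
  move=> i_off; apply: s2_fix; rewrite D_xyz -gx -gy -gz.
  by rewrite (mem_map (@perm_inj _ g) [:: ord6 0; ord6 3; ord6 5]).
have iso_of_s2 (w : 'S_6) : (forall i, i \notin [:: ord6 0; ord6 3; ord6 5] -> w i = i) ->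
    s.2 x = g (w (ord6 0)) -> s.2 y = g (w (ord6 3)) -> s.2 z = g (w (ord6 5)) ->
    tree_iso s (black_rotation, w).
  move=> w_off w0 w3 w5; apply: iso_of.
  by elim/ord6P; rewrite ?gx ?gy ?gz // w_off // s2_off.
(* [s.2 x] is [y] or [z]; either choice determines the whole 3-cycle and gives one of the two
   models. *)
have := Dx 1%N; have := Dx 2; move: x2_uniq; rewrite /= !inE negb_or -andbA.
case/and4P=> nx1 nx2 n12 _; rewrite !(eq_sym _ x) (negPf nx1) (negPf nx2) /=.
move=> x2 /orP[]/eqP x1; move: x2 n12 s2x; rewrite x1.
  rewrite (eq_sym y) => /orP[/eqP->|/eqP x2 _]; rewrite ?eqxx // x2 => s2z.
  left; apply: iso_of_s2; first by elim/ord6P => // _; rewrite permE.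
  - by rewrite x1 -gy; congr (g _); rewrite permE; apply: val_inj.
  - by rewrite x2 -gz; congr (g _); rewrite permE; apply: val_inj.
  by rewrite s2z -gx; congr (g _); rewrite permE; apply: val_inj.
rewrite (eq_sym z) => /orP[/eqP x2 _|/eqP->]; rewrite ?eqxx // x2 => s2y.
right; apply: iso_of_s2; first by elim/ord6P => // _; rewrite permE.
- by rewrite x1 -gz; congr (g _); rewrite permE; apply: val_inj.
- by rewrite s2y -gx; congr (g _); rewrite permE; apply: val_inj.
by rewrite x2 -gy; congr (g _); rewrite permE; apply: val_inj.
Qed.

Lemma exactly_two_plane_trees :
  exactly_two_classes
    (fun s : 'S_6 * 'S_6 => plane_tree s /\ tree_has_passport passport_321 s)
    (@tree_iso 6).
Proof.
exists (black_rotation, white_rotation), (black_rotation, mirror_white_rotation).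
split; [exact: plane_tree_white | exact: plane_tree_mirror_white | exact: mirror_trees_not_iso |].
by move=> s [s_tree s_pass]; apply: plane_tree_321_classification.
Qed.

(** * The field of Gaussian numbers *)

Definition rat_gaussian (x : algC) : bool := ('Re x \in Crat) && ('Im x \in Crat).

Lemma rat_gaussianP (x : algC) :
  reflect (exists r : rat * rat, x = ratr r.1 + ratr r.2 * 'i) (rat_gaussian x).
Proof.
apply: (iffP andP) => [[/CratP[r Dr] /CratP[s Ds]] | [[r s] /= ->]].
  by exists (r, s); rewrite /= [LHS]Crect Dr Ds [ratr s * _]mulrC.
have Rr (t : rat) : (ratr t : algC) \is Num.real by rewrite Creal_Crat ?Crat_rat.
by rewrite [_ * 'i]mulrC Re_rect ?Im_rect ?Rr ?Crat_rat.
Qed.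

Lemma rat_gaussian_eq (r s : rat * rat) :
  ratr r.1 + ratr r.2 * 'i = ratr s.1 + ratr s.2 * 'i :> algC -> r = s.
Proof.
have Rr (t : rat) : (ratr t : algC) \is Num.real by rewrite Creal_Crat ?Crat_rat.
case: r s => [r1 r2] [s1 s2] /=; rewrite ![_ * 'i]mulrC => eq_rs.
have := congr1 (fun z => 'Re z) eq_rs; have := congr1 (fun z => 'Im z) eq_rs.
by rewrite !Re_rect ?Im_rect ?Rr // => /fmorph_inj-> /fmorph_inj->.
Qed.

Lemma rat_gaussian_closed : divring_closed rat_gaussian.
Proof.
have gM x y : rat_gaussian x -> rat_gaussian y -> rat_gaussian (x * y).
  move=> /rat_gaussianP[r ->] /rat_gaussianP[s ->]; apply/rat_gaussianP.
  exists (r.1 * s.1 - r.2 * s.2, r.1 * s.2 + r.2 * s.1) => /=.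
  rewrite !(rmorphB, rmorphD, rmorphM) /=.
  have := sqrCi algC; move: (ratr r.1) (ratr r.2) (ratr s.1) (ratr s.2) 'i => a b c d j jj.
  by rewrite [X in X - _]/= -(opprK (b * d)) -mulrN1 -jj; ring.
split=> [|x y gx gy|x y gx gy].
- by apply/rat_gaussianP; exists (1, 0); rewrite rmorph1 rmorph0 mul0r addr0.
- move: gx gy => /rat_gaussianP[r ->] /rat_gaussianP[s ->].
  apply/rat_gaussianP; exists (r.1 - s.1, r.2 - s.2) => /=.
  by rewrite !rmorphB mulrBl opprD addrACA.
have conj_rat (q : rat) : (ratr q : algC)^* = ratr q.
  by rewrite conj_Creal // Creal_Crat ?Crat_rat.
(* Division reduces to multiplication by the conjugate and by the inverse of the rational norm; the
   convention that 0 is its own inverse covers y = 0. *)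
have ->: x / y = x * (y^* * (y * y^*)^-1).
  have [->|ny] := eqVneq y 0; first by rewrite mul0r !invr0 !mulr0.
  by congr (_ * _); rewrite invfM mulrCA [X in _ * X]divff ?conjC_eq0 ?mulr1.
apply: (gM _ _ gx); case/rat_gaussianP: gy => s ->; apply: gM.
  apply/rat_gaussianP; exists (s.1, - s.2).
  by rewrite rmorphD (rmorphM Num.conj (ratr s.2)) /= !conj_rat conjCi rmorphN mulrN mulNr.
apply/rat_gaussianP; exists ((s.1 ^+ 2 + s.2 ^+ 2)^-1, 0).
rewrite rmorphD (rmorphM Num.conj (ratr s.2)) /= !conj_rat conjCi.
rewrite rmorph0 mul0r addr0 mulrN [_ * (_ - _)]mulrC -subr_sqr (exprMn _ _ 'i) sqrCi mulrN1 opprK.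
by rewrite fmorphV rmorphD !rmorphXn.
Qed.

Lemma in_rational_adjunction_iP (x : algC) :
  in_rational_adjunction 'i x <-> rat_gaussian x.
Proof.
split=> [/(_ rat_gaussian rat_gaussian_closed)|/rat_gaussianP[r ->] S S_div Si].
  apply; apply/rat_gaussianP; exists (0, 1).
  by rewrite rmorph0 rmorph1 mul1r add0r.
pose SdivM := GRing.isDivringClosed.Build _ S S_div.
pose SD : divringClosed algC := HB.pack S SdivM.
have Srat q : ratr q \in S by exact: (rpred_rat SD q).
by apply: (rpredD (S := SD)); [exact: Srat | apply: (@rpredM _ SD); [exact: Srat | exact: Si]].
Qed.

(* The minimal polynomials of [x] and [z] have a splitting field that is      *)
(* Galois over Q(z), and whose automorphisms extend to algC.                  *)
Lemma algC_fixed_subfield (S : {pred algC}) (z x : algC) :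
    divring_closed S -> z \in S ->
    (forall sigma : {rmorphism algC -> algC}, sigma z = z -> sigma x = x) ->
  x \in S.
Proof.
move=> S_div Sz fix_x.
have [px [Dpx mon_px] dv_px] := minCpolyP x.
have [pz [Dpz mon_pz] dv_pz] := minCpolyP z.
pose P := px * pz.
have [rs DP] := closed_field_poly_normal (map_poly ratr P : {poly algC}).
have monP : map_poly ratr P \is (@monic algC) by rewrite monic_map /P ?monicMl.
rewrite (monicP monP) scale1r in DP.
have [Qs [QsC [s1 Ds1 s1_gen]]] := num_field_exists rs.
have rs_x : x \in rs.
  by rewrite -root_prod_XsubC -DP rmorphM /= rootM -Dpx root_minCpoly.
have rs_z : z \in rs.
  by rewrite -root_prod_XsubC -DP rmorphM /= rootM -Dpz root_minCpoly orbT.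
rewrite -Ds1 in rs_x rs_z; have /mapP[x1 _ Dx] := rs_x; have /mapP[z1 _ Dz] := rs_z.
have splitQs : SplittingField.axiom Qs.
  exists (map_poly (in_alg Qs) P).
    by apply/polyOverP => i; rewrite coef_map /= rpredZ ?mem1v.
  exists s1 => //; rewrite (_ : map_poly _ _ = \prod_(y <- s1) ('X - y%:P)) ?eqpxx //.
  apply: (map_poly_inj QsC); rewrite -map_poly_comp rmorph_prod /=.
  rewrite (eq_map_poly (g := ratr)) => [|q /=]; last by rewrite alg_num_field fmorph_rat.
  rewrite DP -Ds1 big_map; apply: eq_bigr => y _; rewrite map_polyXsubC //.
pose L : splittingFieldType rat := HB.pack Qs (FieldExt_isSplittingField.Build _ Qs splitQs).
pose K := <<1; z1 : L>>%AS.
have galK : galois K {:L}.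
  apply/and3P; split; rewrite ?subvf ?normalFieldf //.
  apply/separableP => y _; apply: pcharf0_separable => p.
  by rewrite (fmorph_pchar (in_alg L)) pchar_num.
(* If [x1] lies in Q(z1), then x is a rational polynomial in z and belongs to [S]. *)
have [x1K | x1K] := boolP ((x1 : L) \in K).
  have /Fadjoin_polyP[p Kp Dx1] := x1K.
  pose SdivM := GRing.isDivringClosed.Build _ S S_div.
  pose SD : divringClosed algC := HB.pack S SdivM.
  rewrite Dx Dx1 horner_coef rmorph_sum /=; apply: (rpred_sum (S := SD)) => i _.
  have /vlineP[q ->] : p`_i \in 1%VS by apply: polyOverP.
  rewrite rmorphM rmorphXn /= -Dz alg_num_field fmorph_rat.
  apply: (@rpredM _ SD); first exact: (rpred_rat SD).
  exact: (@rpredX _ SD).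
(* Otherwise some Galois element over Q(z1) moves [x1], and its extension to [algC] fixes z but
   moves x. *)
rewrite -(galois_fixedField galK) in x1K.
have [g gK g_x1] : exists2 g, g \in 'Gal({:L} / K)%g & g (x1 : L) != x1.
  apply/exists_inP; rewrite -negb_forall_in; apply: contra x1K.
  by move/forall_inP=> g_x1; apply/(fixedFieldP (memvf _)) => g /g_x1/eqP.
have [nu Dnu] := extend_algC_subfield_aut QsC g.
case/eqP: g_x1; apply: (fmorph_inj QsC); rewrite Dnu -Dx fix_x //.
by rewrite Dz -Dnu; congr (QsC _); apply: (fixed_gal _ gK); rewrite ?subvf ?memv_adjoin.
Qed.

(** * The resultant *)

(** The value is p1^2 q(-p0/p1) with denominators cleared. *)
Lemma resultant_size2_size3 (R : comNzRingType) (p q : {poly R}) :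
  size p = 2 -> size q = 3 ->
  resultant p q = p`_1 ^+ 2 * q`_0 - p`_0 * p`_1 * q`_1 + p`_0 ^+ 2 * q`_2.
Proof.
move=> sz_p sz_q.
(* The matrix dimension depends on the sizes of p and q; describing the entries without reference to
   them allows the sizes to be replaced by literals. *)
have SylE (i j : 'I_((size q).-1 + (size p).-1)) : Sylvester_mx p q i j =
    if (i < 2)%N then ('X ^+ i * p)`_j else ('X ^+ (i - 2) * q)`_j.
  rewrite Sylvester_mxE; case: splitP => k Dk.
    have k_lt2 : (k < 2)%N by apply: leq_trans (ltn_ord k) _; rewrite sz_q.
    by rewrite Dk k_lt2 coefXnM; case: (ltnP j k).
  have -> : i = (2 + k)%N :> nat by rewrite Dk; congr addn; rewrite sz_q.
  have -> : (2 + k < 2)%N = false by rewrite ltnNge leq_addr.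
  by rewrite addKn coefXnM; case: (ltnP j k).
rewrite /resultant.
have -> : Sylvester_mx p q =
    \matrix_(i < (size q).-1 + (size p).-1, j < (size q).-1 + (size p).-1)
      if (i < 2)%N then ('X ^+ i * p)`_j else ('X ^+ (i - 2) * q)`_j.
  by apply/matrixP => i j; rewrite SylE mxE.
rewrite sz_p sz_q /=.
rewrite !(expand_det_row _ ord0) !big_ord_recl !big_ord0.
rewrite /cofactor !(expand_det_row _ ord0) !big_ord_recl !big_ord0 /cofactor !det_mx11 !mxE /=.
rewrite /bump /= !coefXnM /= (nth_default _ (_ : (size p <= 2)%N)) ?sz_p //.
by ring.
Qed.

Lemma rmorph_quadratic_factor (R S : comNzRingType) (f : {rmorphism R -> S}) (a : R) :
  f (quadratic_factor a) = quadratic_factor (f a).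
Proof. by rewrite /quadratic_factor !(rmorph_nat, rmorphXn, rmorphM, rmorphB, rmorphD). Qed.

Lemma rmorph_E1 (R S : comNzRingType) (f : {rmorphism R -> S}) (a c : R) :
  f (E1 a c) = E1 (f a) (f c).
Proof. by rewrite /E1 !(rmorph_nat, rmorphXn, rmorphM, rmorphB, rmorphD). Qed.

Lemma horner_E1 (R : comNzRingType) (x : R) : (E1 'X 1).[x] = E1 x 1.
Proof.
have := rmorph_E1 (horner_eval x) 'X 1.
by rewrite rmorph1 /=; have -> : horner_eval x 'X = x by apply: hornerX.
Qed.

Lemma E1_linear (R : comNzRingType) (a c : R) :
  E1 a c = (E1 a 1 - 93312%:R) * c + 93312%:R.
Proof. by rewrite /E1; ring. Qed.

Lemma E1_E2_resultant : resultant E1_poly E2_poly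
  = - (432%:R * quadratic_factor 'X ^+ 3 * cubic_factor 'X ^+ 2).
Proof.
have kE : (93312%:R : rat)%:P = 93312%:R by exact: polyC_natr.
(* [k] is folded because simplification would unfold the large numeral. *)
pose k : {poly rat} := (93312%:R)%:P.
pose P : {poly rat} := E1 'X 1 - k; pose Q : {poly rat} := 'X ^+ 4 * ('X - 1) ^+ 3.
have D1 : E1_poly = P *: 'X + k%:P.
  have polyCE (b : {poly rat}) : (E1 'X 1 - b)%:P = E1 'X%:P 1 - b%:P.
    by rewrite polyCB (rmorph_E1 polyC).
  rewrite -mul_polyC /P polyCE /k kE.
  have -> : (93312%:R : {poly rat})%:P = 93312%:R by exact: polyC_natr.
  exact: E1_linear.
have D2 : E2_poly = Q *: 'X^2 - (432%:R)%:P.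
  rewrite -mul_polyC /Q rmorph_nat rmorphM /= !rmorphXn /= rmorphB /= rmorph1.
  by [].
have P0 : P != 0.
  have P0E (e : {poly rat}) (b : rat) : (e - b%:P).[0] = e.[0] - b.
    by rewrite hornerD hornerN hornerC.
  apply: contraTneq isT => /(congr1 (fun p : {poly rat} => p.[0])) /eqP.
  rewrite P0E horner_E1 horner0.
  have -> : E1 0 1 - 93312%:R = - 1024%:R :> rat by rewrite /E1; ring.
  by rewrite oppr_eq0 pnatr_eq0.
have Q0 : Q != 0 by rewrite mulf_neq0 ?expf_neq0 ?polyX_eq0 -?polyC1 ?polyXsubC_eq0.
have sz1 : size E1_poly = 2.
  by rewrite D1 size_addl size_scale ?size_polyX // ltnS size_polyC_leq1.
have sz2 : size E2_poly = 3.
  by rewrite D2 size_addl ?size_opp size_scale ?size_polyXn // ltnS (leq_trans (size_polyC_leq1 _)).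
(* With E1 = P c + k and E2 = Q c^2 - 432 the resultant is k^2 Q - 432 P^2. *)
rewrite (resultant_size2_size3 sz1 sz2) D1 D2 !coefD !coefN !coefZ !coefX !coefXn !coefC /=.
by rewrite /P /k kE /Q /E1 /quadratic_factor /cubic_factor; ring.
Qed.

Lemma horner_quadratic_factor (F : comNzRingType) (x : F) :
  (quadratic_factor 'X).[x] = quadratic_factor x.
Proof.
have := rmorph_quadratic_factor (horner_eval x) 'X; rewrite /=.
by have -> : horner_eval x 'X = x by apply: hornerX.
Qed.

Lemma quadratic_factor_irreducible : irreducible_poly (quadratic_factor ('X : {poly rat})).
Proof.
have D : quadratic_factor 'X = 25%:R *: 'X^2 + (16%:R%:P - 32%:R *: 'X) :> {poly rat}.
  by rewrite -!mul_polyC !polyC_natr /quadratic_factor; ring.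
apply: cubic_irreducible => [|x].
  rewrite D size_addl size_scale ?size_polyXn // ltnS.
  rewrite (leq_trans (size_add _ _)) // geq_max size_opp size_scale // size_polyX.
  by rewrite (leq_trans (size_polyC_leq1 _)).
rewrite /root horner_quadratic_factor.
apply: lt0r_neq0; rewrite /quadratic_factor.
(* A quadratic is irreducible once it has no rational root; here it equals (5x - 16/5)^2 + 144/25,
   which is positive. *)
have := sqr_ge0 (5%:R * x - 16%:R / 5%:R); nra.
Qed.

(** * The Galois action *)

(** The representative of the tree attached to a root [a]; as it commutes with field morphisms, the
    Galois action on trees becomes the action on [a]. *)
Definition tree_model (K : numClosedFieldType) (a : K) : {poly K} :=
  normal_form a (normal_form_scale a).

Section Orbit.

Variables (C : numClosedFieldType) (iota : {rmorphism algC -> C}).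

Local Notation tree := (@tree_polynomial C passport_321).

Lemma tree_model_tree (K : numClosedFieldType) (a : K) :
  quadratic_factor a = 0 -> tree_polynomial passport_321 (tree_model a).
Proof.
by move=> qa; apply/tree_normal_formP; split; last exact/(E1_quadratic_root _ qa).
Qed.

Lemma tree_polynomial_model (K : numClosedFieldType) (p : {poly K}) :
  tree_polynomial passport_321 p -> exists2 a, quadratic_factor a = 0 & belyi_iso p (tree_model a).
Proof.
move=> tp; have [a [c p_ac]] := tree_normal_form tp.
have /tree_normal_formP[qa /(E1_quadratic_root _ qa) Dc] :=
  (belyi_iso_tree passport_321 p_ac).1 tp.
by exists a; rewrite // /tree_model -Dc.
Qed.

Lemma tree_model_unique (K : numClosedFieldType) (p : {poly K}) (a b : K) :
  quadratic_factor a = 0 -> quadratic_factor b = 0 ->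
  belyi_iso p (tree_model a) -> belyi_iso p (tree_model b) -> a = b.
Proof.
move=> qa qb /belyi_iso_sym pa pb.
by have [] := normal_form_unique (tree_model_tree qa) (tree_model_tree qb) (belyi_iso_trans pa pb).
Qed.

Lemma tree_model_map (F K : numClosedFieldType) (f : {rmorphism F -> K}) (a : F) :
  map_poly f (tree_model a) = tree_model (f a).
Proof. by rewrite normal_form_map normal_form_scale_map. Qed.

Lemma quadratic_root_map (F K : numClosedFieldType) (f : {rmorphism F -> K}) (a : F) :
  quadratic_factor a = 0 -> quadratic_factor (f a) = 0.
Proof. by rewrite -rmorph_quadratic_factor => ->; rewrite rmorph0. Qed.

Lemma quadratic_root_algebraic (a : C) : quadratic_factor a = 0 ->
  exists2 a0 : algC, quadratic_factor a0 = 0 & a = iota a0.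
Proof.
move=> qa; have [||a0 qa0 ->] := @root_map_poly_closed _ _ iota (quadratic_factor 'X) a.
- rewrite -size_poly_gt0; apply: contraTT isT; rewrite -eqn0Ngt size_poly_eq0 => /eqP E0.
  have := horner_quadratic_factor (0 : algC); rewrite E0 horner0 /quadratic_factor.
  rewrite expr0n /= !mulr0 subr0 add0r => /eqP.
  by rewrite eq_sym pnatr_eq0.
- rewrite (rmorph_quadratic_factor (map_poly iota)) /= map_polyX.
  by apply/eqP; rewrite horner_quadratic_factor.
by exists a0; rewrite // -horner_quadratic_factor; apply/eqP.
Qed.

Lemma exactly_two_tree_polynomials : exactly_two_classes tree (@belyi_iso C).
Proof.
have [qp qm] : quadratic_factor ((16%:R + 12%:R * 'i) / 25%:R : C) = 0
    /\ quadratic_factor ((16%:R - 12%:R * 'i) / 25%:R : C) = 0.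
  by split; apply/quadratic_factor_roots; [left | right].
exists (tree_model ((16%:R + 12%:R * 'i) / 25%:R)), (tree_model ((16%:R - 12%:R * 'i) / 25%:R)).
split; [exact: tree_model_tree | exact: tree_model_tree | | ].
  move=> pm; case/eqP: (quadratic_roots_neq C); apply: tree_model_unique qp qm _ pm.
  by exists 1, 0; rewrite oner_eq0 scale1r addr0 comp_polyXr.
by move=> p /tree_polynomial_model[a /quadratic_factor_roots[->|->]]; auto.
Qed.

Lemma fmorph_i (sigma : {rmorphism algC -> algC}) : sigma 'i = 'i \/ sigma 'i = - 'i.
Proof.
have : sigma 'i ^+ 2 == 'i ^+ 2 by rewrite -rmorphXn /= sqrCi rmorphN1.
by rewrite eqf_sqr => /orP[]/eqP; auto.
Qed.

Lemma fix_quadratic_root (sigma : {rmorphism algC -> algC}) (a : algC) :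
  quadratic_factor a = 0 -> sigma a = a <-> sigma 'i = 'i.
Proof.
(* The sign e = 1 or -1 treats both roots at once; i is recovered rationally from the root. *)
have sigma_pm (e : algC) : e * e = 1 -> sigma e = e ->
    sigma ((16%:R + 12%:R * (e * 'i)) / 25%:R) = (16%:R + 12%:R * (e * 'i)) / 25%:R
    <-> sigma 'i = 'i.
  move=> ee sigma_e.
  rewrite fmorph_div rmorphD !rmorphM !rmorph_nat sigma_e.
  split=> [|-> //] /(congr1 (fun z => e * ((z * 25%:R - 16%:R) / 12%:R))).
  have E (z : algC) :
      e * (((16%:R + 12%:R * (e * z)) / 25%:R * 25%:R - 16%:R) / 12%:R) = (e * e) * z.
    by field.
  by rewrite !E ee !mul1r.
case/quadratic_factor_roots => ->.
  have := sigma_pm 1; rewrite mulr1 rmorph1 mul1r; exact.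
have := sigma_pm (-1); rewrite mulrNN mulr1 rmorphN1 mulN1r mulrN; exact.
Qed.

(** The model in the definition of conjugacy is arbitrary; normalizing it over [algC] before
    applying [sigma] makes both sides normal forms. *)
Lemma galois_conjugate_tree (sigma : {rmorphism algC -> algC}) (p q : {poly C}) :
  tree p -> galois_conjugate iota sigma p q ->
  exists a : algC, [/\ quadratic_factor a = 0, belyi_iso p (tree_model (iota a))
    & belyi_iso q (tree_model (iota (sigma a)))].
Proof.
move=> tp [m [pm qm]].
have /tree_polynomial_map/tree_polynomial_model[a qa ma] := (belyi_iso_tree passport_321 pm).1 tp.
exists a; split=> //; rewrite -?tree_model_map.
  exact: belyi_iso_trans pm (belyi_iso_map iota ma).
exact: belyi_iso_trans qm (belyi_iso_map iota (belyi_iso_map sigma ma)).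
Qed.

Lemma galois_conjugate_model (sigma : {rmorphism algC -> algC}) (p q : {poly C}) (a : algC) :
  belyi_iso p (tree_model (iota a)) -> belyi_iso q (tree_model (iota (sigma a))) ->
  galois_conjugate iota sigma p q.
Proof. by move=> pa qa; exists (tree_model a); rewrite !tree_model_map. Qed.

Lemma tree_galois_orbit (p q : {poly C}) : tree p ->
  tree q <-> exists sigma : {rmorphism algC -> algC}, galois_conjugate iota sigma p q.
Proof.
move=> tp; split=> [tq | [sigma /(galois_conjugate_tree tp)[a [qa _ q_a]]]]; last first.
  apply/(belyi_iso_tree passport_321 q_a)/tree_model_tree.
  by do 2!apply: quadratic_root_map.
have [_ /quadratic_root_algebraic[a qa ->] pa] := tree_polynomial_model tp.
have [_ /quadratic_root_algebraic[b qb ->] pb] := tree_polynomial_model tq.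
suffices [sigma Db] : exists sigma : {rmorphism algC -> algC}, sigma a = b.
  by exists sigma; apply: (galois_conjugate_model pa); rewrite Db.
(* Distinct roots are exchanged by complex conjugation. *)
have [-> | nab] := eqVneq a b; first by exists idfun.
exists Num.conj; move: nab.
have conj_root (e : algC) : ((16%:R + 12%:R * e) / 25%:R)^* = (16%:R + 12%:R * e^*) / 25%:R.
  by rewrite fmorph_div rmorphD rmorphM !rmorph_nat.
case/quadratic_factor_roots: qa => ->; case/quadratic_factor_roots: qb => ->;
  rewrite ?eqxx //= => _.
  by rewrite conj_root conjCi mulrN.
by rewrite -mulrN conj_root (rmorphN Num.conj 'i) /= conjCi opprK.
Qed.

Lemma in_galois_stabilizer_tree (sigma : {rmorphism algC -> algC}) (p : {poly C}) :
  tree p -> in_galois_stabilizer iota p sigma <-> sigma 'i = 'i.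
Proof.
move=> tp; split=> [/(galois_conjugate_tree tp)[a [qa pa p_sa]] | sigma_i].
  apply/(fix_quadratic_root sigma qa)/esym/(fmorph_inj iota).
  by apply: tree_model_unique pa p_sa; do ?apply: quadratic_root_map.
have [_ /quadratic_root_algebraic[a qa ->] pa] := tree_polynomial_model tp.
by apply: (galois_conjugate_model pa); rewrite ((fix_quadratic_root sigma qa).2 sigma_i).
Qed.

Lemma tree_field_of_moduli (p : {poly C}) (x : algC) : tree p ->
  in_field_of_moduli iota p x <-> in_rational_adjunction 'i x.
Proof.
move=> tp; split=> [p_x S S_div S_i | x_i sigma /(in_galois_stabilizer_tree sigma tp) sigma_i].
  apply: (algC_fixed_subfield S_div S_i) => sigma sigma_i.
  by apply: p_x; apply/in_galois_stabilizer_tree.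
(* The elements fixed by [sigma] form a subfield containing i. *)
apply/eqP; apply: (x_i [pred y | sigma y == y]); last by rewrite inE sigma_i.
split=> [|y z|y z]; rewrite !inE ?rmorph1 //.
  by rewrite rmorphB => /eqP-> /eqP->.
by rewrite fmorph_div => /eqP-> /eqP->.
Qed.

End Orbit.

Theorem theorem10p6 (R : realType) (iota : {rmorphism algC -> R[i]}) :
  let tree := @tree_polynomial R[i] passport_321 in
  (* exactly two plane trees, as embedded graphs and as polynomial maps *)
  exactly_two_classes
    (fun s : 'S_6 * 'S_6 => plane_tree s /\ tree_has_passport passport_321 s)
    (@tree_iso 6)
  /\ exactly_two_classes tree (@belyi_iso R[i])
  (* they form a single Galois orbit *)
  /\ (forall p q : {poly R[i]}, tree p ->
        (tree q <-> exists sigma : {rmorphism algC -> algC},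
                      galois_conjugate iota sigma p q))
  (* the field of moduli of each of them is Q(i) *)
  /\ (forall (p : {poly R[i]}) (x : algC), tree p ->
        (in_field_of_moduli iota p x <-> in_rational_adjunction 'i x))
  (* Q(i) is imaginary quadratic, with basis 1, i over Q, and is normal *)
  /\ (forall x : algC, in_rational_adjunction 'i x <->
        exists! r : rat * rat, x = ratr r.1 + ratr r.2 * 'i)
  /\ ('i : algC) \isn't Num.real
  /\ (forall (sigma : {rmorphism algC -> algC}) (x : algC),
        in_rational_adjunction 'i x -> in_rational_adjunction 'i (sigma x))
  (* each tree has a unique normal form *)
  /\ (forall p : {poly R[i]}, tree p ->
        exists! ac : R[i] * R[i], belyi_iso p (normal_form ac.1 ac.2))
  (* the normal forms are those of the roots of the quadratic factor *)
  /\ (forall a c : R[i],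
        tree (normal_form a c) <-> quadratic_factor a = 0 /\ E1 a c = 0)
  /\ (forall a : R[i], quadratic_factor a = 0 -> exists! c : R[i], E1 a c = 0)
  /\ (forall a : R[i], quadratic_factor a = 0 <->
        a = (16%:R + 12%:R * 'i) / 25%:R \/ a = (16%:R - 12%:R * 'i) / 25%:R)
  (* E1 = E2 = 0 says that p takes the value 1 at its other critical points *)
  /\ (forall a c u v : R[i],
        6%:R *: 'X ^+ 2 - (4%:R + 5%:R * a) *: 'X + (3%:R * a)%:P
          = 6%:R *: (('X - u%:P) * ('X - v%:P)) ->
        (E1 a c = 0 /\ E2 a c = 0 <->
         (normal_form a c).[u] = 1 /\ (normal_form a c).[v] = 1))
  (* the resultant *)
  /\ resultant E1_poly E2_poly
       = - (432%:R * quadratic_factor 'X ^+ 3 * cubic_factor 'X ^+ 2)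
  /\ irreducible_poly (quadratic_factor ('X : {poly rat})).
Proof.
split; first exact: exactly_two_plane_trees.
split; first exact: exactly_two_tree_polynomials.
split; first exact: tree_galois_orbit.
split; first exact: tree_field_of_moduli.
split.
  move=> x; rewrite in_rational_adjunction_iP; split=> [/rat_gaussianP[r Dx]|[r [Dx _]]].
    by exists r; split=> // s; rewrite Dx; apply: rat_gaussian_eq.
  by apply/rat_gaussianP; exists r.
split; first exact: nonRealCi.
split.
  move=> sigma x /in_rational_adjunction_iP/rat_gaussianP[r ->].
  apply/in_rational_adjunction_iP/rat_gaussianP.
  rewrite rmorphD (rmorphM sigma (ratr r.2)) /= !fmorph_rat.
  by case: (fmorph_i sigma) => ->; [exists r | exists (r.1, - r.2); rewrite rmorphN mulNr mulrN].
split.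
  move=> p tp; have [a qa pa] := tree_polynomial_model tp.
  exists (a, normal_form_scale a); split=> // -[b d] /= p_bd.
  have [-> -> //] := normal_form_unique (tree_model_tree qa) ((belyi_iso_tree _ p_bd).1 tp)
    (belyi_iso_trans (belyi_iso_sym pa) p_bd).
split; first exact: tree_normal_formP.
split.
  move=> a qa; exists (normal_form_scale a); split; first exact/(E1_quadratic_root _ qa).
  by move=> c /(E1_quadratic_root _ qa).
split; first exact: quadratic_factor_roots.
split; first exact: E1_E2_critical_values.
split; first exact: E1_E2_resultant.
exact: quadratic_factor_irreducible.
Qed.
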